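(* Every $F$-invariant probability measure $\mu$ in $\Lambda$ is hyperbolic. The two Lyapunov exponents are $$\int\log\left|\frac{\partial g}{\partial y}\right|\,d\mu\;<\;0\;<\;\int\log|f'|\circ\pi_1\,d\mu\;\le\;+\infty,$$ where $\pi_1(x,y)=x$.
   Context: Setting. $f$ is a map of $[-1,1]$ with a discontinuity at $0$, given by two branches, each an increasing $\mathcal C^{1+}$-diffeomorphism ($C^1$ with locally Hölder derivative): from $[-1,0[$ onto $[v_l,1[$ and from $]0,1]$ onto $]-1,v_r]$, where $-1<v_l<0<v_r<1$. One has $f'\ge\sqrt2$, and $f'(x)$ is of the form $1/|x|^{1-\rho}$ for $x$ close to $0$, with $\rho\in(0,1)$, so $f'(x)\to+\infty$ as $x\to0^\pm$. At $0$, $f$ is bi-valued: $f(0^-)=1$, $f(0^+)=-1$. The map $g$ is $\mathcal C^{1+}$ from $([-1,0)\cup(0,1])\times[-1,1]$ to $[-1,1]$ and extends to $\{0\}\times[-1,1]$ as a bi-valued map with $g(0^-,y)=y_+>0$ and $g(0^+,y)=y_-<0$ for every $y$, where $y_\pm\in]-1,1[$; moreover $|\partial g/\partial y|\le \frac12$ and $|\partial g/\partial x|\le M$ for some $M>0$. Put $F(x,y)=(f(x),g(x,y))$ on $[-1,1]^2$. $F$ maps $[-1,1]^2$ strictly into itself, maps the left part ($x<0$) and the right part ($x>0$) onto two disjoint ''triangles'', and is one-to-one except on the critical line $\{0\}\times[-1,1]$, whose two images are the points $(1,y_+)$ and $(-1,y_-)$. Standing assumption: $0$ is neither periodic nor pre-periodic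 for $f$. The attractor is $\Lambda=\bigcap_{n\ge0}F^n([-1,1]^2)$. A measure is hyperbolic if its Lyapunov exponents (for the derivative cocycle $DF$) are all nonzero. Invariance is the usual one, $\mu(F^{-1}(B))=\mu(B)$ for Borel $B$, with $F$ given one of its two values on the critical line. *)

(* Defs.v *)
From HB Require Import structures.
From mathcomp Require Import all_boot all_order all_algebra.
From mathcomp Require Import all_classical all_reals all_analysis.
From mathcomp Require Import measurable_realfun.

Set Implicit Arguments.
Unset Strict Implicit.
Unset Printing Implicit Defensive.

Import Order.TTheory GRing.Theory Num.Theory.
Import numFieldNormedType.Exports.

Local Open Scope classical_set_scope.
Local Open Scope ring_scope.

(* Derivatives relative to a set [A]: one-sided at the end points of an
   interval, so that nothing is assumed about (or depends on) the values of
   [f] outside [A]. *)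
Definition diff_quot_on {R : realType} (A : set R) (f : R -> R) (x : R) :=
  (fun h : R => h^-1 * (f (x + h) - f x)) @ within [set h | A (x + h)] (0 : R)^'.

Definition derivable_on {R : realType} (A : set R) (f : R -> R) (x : R) : Prop :=
  cvg (diff_quot_on A f x).

Definition derive_on {R : realType} (A : set R) (f : R -> R) (x : R) : R :=
  lim (diff_quot_on A f x).

Definition locally_hoelder {R : realType} {V : normedModType R}
    (A : set V) (h : V -> R) : Prop :=
  forall x, A x -> exists U (C a : R), [/\ nbhs x U, 0 < a <= 1 &
    forall u v, A u -> A v -> U u -> U v -> `|h u - h v| <= C * `|u - v| `^ a].

Section LorenzLikeMaps.
Variable R : realType.

Local Notation plane := (R * R)%type.

Definition dom_f : set R := `[-1, 0[ `|` `]0, 1].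
Definition square : set plane := `[-1, 1] `*` `[-1, 1].
Definition dom_F : set plane := dom_f `*` `[-1, 1].

Variables (f : R -> R) (g : R -> R -> R).

Definition df (x : R) : R := derive_on dom_f f x.
Definition dg_x (z : plane) : R := derive_on dom_f (g ^~ z.2) z.1.
Definition dg_y (z : plane) : R := derive_on `[-1, 1] (g z.1) z.2.

Definition f_step (x x' : R) : Prop :=
  (dom_f x /\ x' = f x) \/ (x = 0 /\ (x' = 1 \/ x' = -1)).

Variables (yp ym : R).

Definition F_step (z z' : plane) : Prop :=
  (dom_F z /\ z' = (f z.1, g z.1 z.2)) \/
  (square z /\ z.1 = 0 /\ (z' = (1, yp) \/ z' = (-1, ym))).

Definition F_image (A : set plane) : set plane :=
  [set z' | exists2 z, A z & F_step z z'].

(* Both images of the critical line belong to the image of [square]. *)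
Definition attractor : set plane :=
  \bigcap_(n in [set: nat]) iter n F_image square.

(* The standing assumptions on (f, g).  The real functions [f] and [g] are only
   meaningful on [dom_f] and [dom_F].  The inverse branches of [f] are
   automatically C^1, since [f' >= sqrt 2]. *)
Record lorenz_like (vl vr rho M : R) : Prop := LorenzLike {
  ll_vl : -1 < vl < 0;
  ll_vr : 0 < vr < 1;
  ll_rho : 0 < rho < 1;
  ll_left_onto : f @` `[-1, 0[ = `[vl, 1[%classic;
  ll_right_onto : f @` `]0, 1] = `]-1, vr]%classic;
  ll_left_incr : {in `[-1, 0[ &, {homo f : x y / x < y}};
  ll_right_incr : {in `]0, 1] &, {homo f : x y / x < y}};
  ll_f_derivable : forall x, dom_f x -> derivable_on dom_f f x;
  ll_f_hoelder : locally_hoelder dom_f df;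
  ll_f_expanding : forall x, dom_f x -> Num.sqrt 2 <= df x;
  (* f' is of the form 1/|x|^(1-rho) near 0, up to bounded positive factors *)
  ll_f_singular : exists c C : R, 0 < c /\
    \forall x \near (0 : R)^',
      c / `|x| `^ (1 - rho) <= df x <= C / `|x| `^ (1 - rho);
  (* 0 is neither periodic nor pre-periodic: an orbit of 0, whichever of the
     two values of f is taken at 0, never visits the same point twice *)
  ll_aperiodic : forall u : nat -> R, u 0%N = 0 ->
    (forall n, f_step (u n) (u n.+1)) -> injective u;
  ll_g_range : forall x y, dom_F (x, y) -> -1 <= g x y <= 1;
  ll_gx_derivable : forall x y, dom_F (x, y) -> derivable_on dom_f (g ^~ y) x;
  ll_gy_derivable : forall x y, dom_F (x, y) -> derivable_on `[-1, 1] (g x) y;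
  ll_gx_hoelder : locally_hoelder dom_F dg_x;
  ll_gy_hoelder : locally_hoelder dom_F dg_y;
  ll_yp : 0 < yp < 1;
  ll_ym : -1 < ym < 0;
  ll_g_left : forall y, -1 <= y <= 1 -> g x y @[x --> 0^'-] --> yp;
  ll_g_right : forall y, -1 <= y <= 1 -> g x y @[x --> 0^'+] --> ym;
  ll_gy_bound : forall z, dom_F z -> `|dg_y z| <= 2^-1;
  ll_M : 0 < M;
  ll_gx_bound : forall z, dom_F z -> `|dg_x z| <= M;
  ll_F_into : F_image square `<` square;
  ll_F_disjoint : F_image (`[-1, 0[ `*` `[-1, 1]) `&`
                  F_image (`]0, 1] `*` `[-1, 1]) = set0;
  ll_F_inj : {in dom_F &, injective (fun z => (f z.1, g z.1 z.2))}
}.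

(* F as a single-valued map: the value on the critical line is the image from
   the left if [b] is true, and the image from the right otherwise. *)
Variable b : bool.

Definition F_map (z : plane) : plane :=
  if z.1 == 0 then (if b then (1, yp) else (-1, ym)) else (f z.1, g z.1 z.2).

(* The derivative of F is lower triangular:
   DF(x, y) = [[ f'(x), 0 ], [ dg/dx, dg/dy ]]. *)
Definition DF (z v : plane) : plane :=
  (df z.1 * v.1, dg_x z * v.1 + dg_y z * v.2).

Fixpoint DF_iter (n : nat) (z v : plane) : plane :=
  if n is k.+1 then DF (iter k F_map z) (DF_iter k z v) else v.

(* The logarithm is extended-real valued, with log 0 = -oo. *)
Definition growth_rate (z v : plane) (n : nat) : \bar R :=
  ((n%:R^-1)%:E * lne (`|DF_iter n z v|)%:E)%E.

Definition on_line (w v : plane) : Prop := exists c : R, v = c *: w.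

(* chi1 <= chi2 are the Lyapunov exponents at z, counted with multiplicity:
   there is a flag 0 < E < R^2 such that nonzero vectors of the line E grow at
   rate chi1 and vectors outside E grow at rate chi2. *)
Definition lyapunov_exponents_at (z : plane) (chi1 chi2 : \bar R) : Prop :=
  (chi1 <= chi2)%E /\ exists w : plane, [/\ w != 0,
    forall v, v != 0 -> on_line w v -> growth_rate z v @ \oo --> chi1 &
    forall v, ~ on_line w v -> growth_rate z v @ \oo --> chi2].

(* The exponents of [mu] are functions defined almost everywhere; they are
   almost everywhere constant when [mu] is ergodic, and are otherwise summed up
   by their means. *)
Definition lyapunov_exponents (mu : probability plane R)
    (chi1 chi2 : plane -> \bar R) : Prop :=
  [/\ measurable_fun [set: plane] chi1, measurable_fun [set: plane] chi2 &
      {ae mu, forall z, lyapunov_exponents_at z (chi1 z) (chi2 z)}].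

Definition hyperbolic_measure (mu : probability plane R) : Prop :=
  exists chi1 chi2 : plane -> \bar R, lyapunov_exponents mu chi1 chi2 /\
    {ae mu, forall z, chi1 z != 0%E /\ chi2 z != 0%E}.

(* [F_map] is only meaningful on [square], which it maps into itself. *)
Definition F_preimage (B : set plane) : set plane :=
  square `&` F_map @^-1` B.

Definition invariant_measure (mu : probability plane R) : Prop :=
  forall B : set plane, measurable B -> mu (F_preimage B) = mu B.

Definition ergodic_measure (mu : probability plane R) : Prop :=
  forall B : set plane, measurable B -> F_preimage B = B ->
    mu B = 0%E \/ mu B = 1%E.

Definition carried_by_attractor (mu : probability plane R) : Prop :=
  {ae mu, forall z, attractor z}.

End LorenzLikeMaps.

(* Main.v *)
Require Import Defs.
From mathcomp Require Import all_boot all_order all_algebra.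
From mathcomp Require Import all_classical all_reals all_analysis.
From mathcomp Require Import measurable_realfun.
From mathcomp Require Import zify ring lra.

Set Implicit Arguments.
Unset Strict Implicit.
Unset Printing Implicit Defensive.

Import Order.TTheory GRing.Theory Num.Theory.
Import numFieldNormedType.Exports.

Local Open Scope classical_set_scope.
Local Open Scope ring_scope.

(* Lines over the orbit of 0 are pairwise disjoint and, by invariance, at least
   as heavy as the critical line; the latter is therefore negligible and almost
   every orbit stays where F is differentiable.  DF is lower triangular, so the
   growth of vertical vectors is the Birkhoff average of log |dg/dy|, while any
   other vector has a vertical component dominated by its horizontal one and
   grows like the Birkhoff average of log |f'|.  Both observables have a sign
   (- log |dg/dy| >= log 2 and log |f'| >= log (sqrt 2)) but may have an
   infinite integral, hence the ergodic theorem is needed for nonnegative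
   extended-valued functions; it follows from a Katznelson-Weiss argument. *)

(** * Birkhoff's ergodic theorem for nonnegative functions *)

Section birkhoff_sum.
Context {X : Type} {R : realType}.
Variable T : X -> X.

(** The multiplicative ergodic theorem is not directly available, since no integrability of the
    log-norm of [DF] is assumed: log |f'| is unbounded near 0, and dg/dy may vanish, which makes log
    |dg/dy| equal to -oo at points and not only in the mean. The triangular form replaces it, with
    the vertical line as the slow direction of the flag. The strict gap between the negative and the
    positive rate then forces every other flag and pair of exponents to coincide with these, which
    is what allows arbitrary measurable [chi1], [chi2]. Limits of averages have to be invariant at
    every point, not just almost everywhere, because the sets cut out by them must satisfy T^-1 E =
    E exactly, both for the maximal inequality and for the definition of ergodicity. Since [f] and
    [g] are uncontrolled off their domains, the map and the observables are given measurable
    extensions to the plane. *)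

Definition birkhoff_sum (h : X -> R) n x := \sum_(k < n) h (iter k T x).

Lemma birkhoff_sumD h m n x :
  birkhoff_sum h (m + n) x = birkhoff_sum h m x + birkhoff_sum h n (iter m T x).
Proof.
rewrite /birkhoff_sum big_split_ord /=; congr (_ + _).
by apply: eq_bigr => k _; rewrite addnC iterD.
Qed.

Lemma birkhoff_sum1 h x : birkhoff_sum h 1 x = h x.
Proof. by rewrite /birkhoff_sum big_ord1. Qed.

Lemma birkhoff_sum_ge0 h n x : (forall y, 0 <= h y) -> 0 <= birkhoff_sum h n x.
Proof. by move=> h0; apply: sumr_ge0. Qed.

Lemma birkhoff_sum_le h h' n x :
  (forall y, h y <= h' y) -> birkhoff_sum h n x <= birkhoff_sum h' n x.
Proof. by move=> hh'; apply: ler_sum. Qed.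

(* Cut the orbit greedily into blocks on each of which the average of [h] is at
   least [lam]; only the last [N] terms are lost. *)
Lemma birkhoff_sum_blocks (E : set X) h (lam : R) N L x :
  (forall y, E y -> E (T y)) -> (forall y, 0 <= h y) -> 0 <= lam ->
  (forall y, E y -> exists n, (0 < n <= N)%N /\ n%:R * lam <= birkhoff_sum h n y) ->
  E x -> (L%:R - N%:R) * lam <= birkhoff_sum h L x.
Proof.
move=> TE h0 lam0 blocks.
elim/ltn_ind: L x => L IH x Ex.
have [LN|NL] := leqP L N.
  apply: (@le_trans _ _ 0); last exact: birkhoff_sum_ge0.
  by rewrite mulr_le0_ge0// subr_le0 ler_nat.
have [n [/andP[n0 nN] hn]] := blocks _ Ex.
have nL : (n <= L)%N by rewrite (leq_trans nN)// ltnW.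
rewrite -(subnKC nL) birkhoff_sumD natrD.
have En : E (iter n T x) by elim: n {n0 nN hn nL} => //= n; exact: TE.
have Ln : (L - n < L)%N by rewrite ltn_subrL n0 (leq_trans n0 nL).
by have := IH _ Ln _ En; lra.
Qed.

End birkhoff_sum.

(** * Upper and lower limits of averages *)

Section invariant_limits.
Context {R : realType}.
Local Open Scope ereal_scope.
Implicit Types (u v : R^nat).

Lemma limn_esup_le_near u (b : R) :
  (\forall n \near \oo, (u n <= b)%R) -> limn_esup (EFin \o u) <= b%:E.
Proof.
move=> [N _ uN]; rewrite limn_esup_lim; apply: lime_le; first exact: is_cvg_esups.
exists N => // m /= Nm; apply: ge_ereal_sup => _ [k /= mk <-].
by rewrite lee_fin; apply: uN; exact: leq_trans mk.
Qed.

Lemma limn_esup_lt_near u (b : R) :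
  limn_esup (EFin \o u) < b%:E -> \forall n \near \oo, (u n < b)%R.
Proof.
have /cvg_lim e := @cvg_esups_inf _ (EFin \o u).
rewrite limn_esup_lim e// => /ereal_inf_lt[_ [N _ <-]] ub.
exists N => // n /= Nn; rewrite -lte_fin; apply: le_lt_trans ub.
by apply: ereal_sup_ubound; exists n.
Qed.

Lemma limn_einf_ge_near u (b : R) :
  (\forall n \near \oo, (b <= u n)%R) -> b%:E <= limn_einf (EFin \o u).
Proof.
move=> bu; rewrite /limn_einf leeNr -EFinN.
have /limn_esup_le_near : \forall n \near \oo, ((\- u) n <= - b)%R.
  by move: bu; apply: filterS => n; rewrite lerN2.
exact.
Qed.

Lemma limn_einf_esup_cvg (u : (\bar R)^nat) :
  limn_einf u = limn_esup u -> u @ \oo --> limn_einf u.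
Proof.
move=> e; apply: (@squeeze_cvge _ _ _ _ (einfs u) u (esups u)).
- apply: nearW => n; apply/andP; split.
    by apply: ereal_inf_lbound; exists n => /=.
  by apply: ereal_sup_ubound; exists n => /=.
- rewrite limn_einf_lim; exact: is_cvg_einfs.
- rewrite e limn_esup_lim; exact: is_cvg_esups.
Qed.

Lemma lte_rat_between (x y : \bar R) :
  x < y -> exists q : rat, x < (ratr q)%:E < y.
Proof.
have rat_between (a b : R) : (a < b)%R -> exists q : rat, (a < ratr q < b)%R.
  by move=> /rat_in_itvoo[q]; rewrite in_itv => ?; exists q.
case: x => [a||]; case: y => [b||] //.
- by rewrite lte_fin => /rat_between[q ?]; exists q; rewrite !lte_fin.
- have [q /andP[aq _]] := rat_between a (a + 1)%R ltac:(by rewrite ltrDl).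
  by move=> _; exists q; rewrite lte_fin aq ltry.
- have [q /andP[_ qb]] := rat_between (b - 1)%R b ltac:(by rewrite gtrBl).
  by move=> _; exists q; rewrite lte_fin qb ltNyr.
- by move=> _; exists 0%R; rewrite ltry ltNyr.
Qed.

(** Rational levels separate two upper limits in the wrong order. Asking only for some b > a leaves
    a margin that absorbs bounded errors in averages, also when the limits are infinite. *)
Lemma le_limn_esup_near u v :
  (forall a b : R, (a < b)%R -> (\forall n \near \oo, (v n <= a)%R) ->
     \forall n \near \oo, (u n <= b)%R) ->
  limn_esup (EFin \o u) <= limn_esup (EFin \o v).
Proof.
move=> uv; rewrite leNgt; apply/negP => vu.
have [b /andP[vb bu]] := lte_rat_between vu.
have [a /andP[va ab]] := lte_rat_between vb.
have /(uv _ (ratr b)) : \forall n \near \oo, (v n <= ratr a)%R.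
  by move: (limn_esup_lt_near va); apply: filterS => n /ltW.
rewrite -lte_fin => /(_ ab)/limn_esup_le_near.
by rewrite leNgt bu.
Qed.

(** This is the invariance of Birkhoff averages: the sum along the orbit of T x is s(n+1) - h(x).
    The margin (b - a) n eventually exceeds the constant a - c or c - a left by the change of
    index. *)
Lemma limn_esup_average_shift (s : R^nat) (c : R) :
  limn_esup (fun n => (n%:R^-1 * (s n.+1 - c))%:E) =
  limn_esup (fun n => (n%:R^-1 * s n)%:E).
Proof.
have large (x e : R) : (0 < e)%R -> \forall n \near \oo, (0 < n%:R :> R)%R /\ (x <= e * n%:R)%R.
  move=> e0; near=> n; split.
    by rewrite ltr0n; near: n; exists 1%N.
  rewrite mulrC -ler_pdivrMr//; near: n; exact: nbhs_infty_ger.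
apply/eqP; rewrite eq_le; apply/andP; split; apply: le_limn_esup_near => a b ab.
  move=> [N _ sN].
  have := large (a - c)%R (b - a)%R; rewrite subr_gt0 => /(_ ab) L.
  near=> n.
  have [n0 nac] : (0 < n%:R :> R)%R /\ (a - c <= (b - a) * n%:R)%R by near: n.
  rewrite mulrC ler_pdivrMr//.
  have : (s n.+1 <= a * n.+1%:R)%R.
    rewrite -ler_pdivrMr// mulrC; apply: sN => /=.
    by apply: leqW; near: n; exists N.
  by rewrite -natr1; lra.
move=> [N _ sN].
have := large (c - a)%R (b - a)%R; rewrite subr_gt0 => /(_ ab) L.
near=> n.
have [n0 nac] : (0 < n%:R :> R)%R /\ (c - a <= (b - a) * n%:R)%R by near: n.
rewrite mulrC ler_pdivrMr//.
have [m [Nm m0 nE]] : exists m, [/\ (N <= m)%N, (0 < m)%N & n = m.+1].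
  have : (N.+2 <= n)%N by near: n; exists N.+2.
  by move=> Nn; exists n.-1; split; lia.
have : (s m.+1 - c <= a * m%:R)%R.
  by rewrite -ler_pdivrMr ?ltr0n// mulrC; exact: sN.
by move: nac; rewrite nE -natr1; lra.
Unshelve. all: by end_near. Qed.

Lemma limn_einf_average_shift (s : R^nat) (c : R) :
  limn_einf (fun n => (n%:R^-1 * (s n.+1 - c))%:E) =
  limn_einf (fun n => (n%:R^-1 * s n)%:E).
Proof.
rewrite /limn_einf; congr (- _).
have := limn_esup_average_shift (\- s)%R (- c)%R.
congr (limn_esup _ = limn_esup _); apply/funext => n /=.
  by rewrite -opprD mulrN.
by rewrite mulrN.
Qed.

End invariant_limits.

(** * Ergodic theorem for nonnegative real-valued functions *)

Section measure_preserving.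
Context d (X : measurableType d) (R : realType) (mu : probability X R).
Variable T : X -> X.
Hypothesis mT : measurable_fun setT T.
Hypothesis invT : forall B, measurable B -> mu (T @^-1` B) = mu B.

Local Notation S := (birkhoff_sum T).

Lemma measurable_iter n : measurable_fun setT (iter n T).
Proof.
elim: n => [|n IH]; first exact: measurable_id.
exact: (measurableT_comp mT IH).
Qed.

Lemma measurable_birkhoff_sum (h : X -> R) n :
  measurable_fun setT h -> measurable_fun setT (S h n).
Proof.
move=> mh; apply: measurable_sum => k.
exact: (measurableT_comp mh (measurable_iter k)).
Qed.

Local Open Scope ereal_scope.

Lemma ge0_integral_comp_invariant (E : set X) (f : X -> \bar R) :
  measurable E -> T @^-1` E = E -> measurable_fun setT f -> (forall x, 0 <= f x) ->
  \int[mu]_(x in E) f (T x) = \int[mu]_(x in E) f x.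
Proof.
move=> mE TE mf f0.
have mfE : measurable_fun E f by exact: measurable_funTS.
have := ge0_integral_pushforward mT mu mE mfE (fun x _ => f0 x).
rewrite TE => <-; apply: eq_measure_integral => A mA _.
exact: invT.
Qed.

Lemma ge0_integral_iter_invariant (E : set X) (f : X -> \bar R) n :
  measurable E -> T @^-1` E = E -> measurable_fun setT f -> (forall x, 0 <= f x) ->
  \int[mu]_(x in E) f (iter n T x) = \int[mu]_(x in E) f x.
Proof.
move=> mE TE mf f0; elim: n => // n IH; rewrite -[RHS]IH.
under eq_integral do rewrite iterSr.
apply: (ge0_integral_comp_invariant (f := fun x => f (iter n T x))) => //.
exact: (measurableT_comp mf (measurable_iter n)).
Qed.

Lemma ge0_integral_birkhoff_sum (E : set X) (h : X -> R) n :
  measurable E -> T @^-1` E = E -> measurable_fun setT h -> (forall x, (0 <= h x)%R) ->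
  \int[mu]_(x in E) (S h n x)%:E = n%:R%:E * \int[mu]_(x in E) (h x)%:E.
Proof.
move=> mE TE mh h0; under eq_integral do rewrite -sumEFin.
have mhE : measurable_fun setT (EFin \o h) by exact/measurable_EFinP.
rewrite ge0_integral_sum//; last 2 first.
- move=> k.
  have mhk : measurable_fun setT (fun x => (h (iter k T x))%:E).
    exact: (measurableT_comp mhE (measurable_iter k)).
  exact: measurable_funTS mhk.
- by move=> k x _; rewrite lee_fin.
under eq_bigr => k _.
  rewrite (ge0_integral_iter_invariant (f := EFin \o h) k)//.
  over.
by rewrite sumr_const card_ord mule_natl.
Qed.

(* Katznelson-Weiss: raise [h] to at least [lam] on the set of the points which
   have to wait longer than [N], of small measure, and cut orbits into blocks. *)
Lemma maximal_inequality (E : set X) (h : X -> R) (lam : R) :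
  measurable E -> T @^-1` E = E -> measurable_fun setT h -> (forall x, (0 <= h x)%R) ->
  (0 <= lam)%R ->
  (forall x, E x -> exists n, (0 < n)%N /\ (n%:R * lam <= S h n x)%R) ->
  lam%:E * mu E <= \int[mu]_(x in E) (h x)%:E.
Proof.
move=> mE TE mh h0 lam0 hE.
pose B N := E `&` [set x | forall n, (n < N)%N -> (S h n.+1 x < n.+1%:R * lam)%R].
have BE N : B N = E `&` \bigcap_(n in [set n | (n < N)%N])
    ((fun x => (n.+1%:R * lam)%:E - (S h n.+1 x)%:E) @^-1` `]0%E, +oo[).
  apply/seteqP; split => x [Ex Bx]; split => // n nN /=.
    by rewrite in_itv/= andbT -EFinB lte_fin subr_gt0; exact: Bx.
  by have := Bx n nN; rewrite /= in_itv/= andbT -EFinB lte_fin subr_gt0.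
have mB N : measurable (B N).
  rewrite BE; apply: measurableI => //; apply: bigcap_measurableType => n _.
  rewrite -[X in measurable X]setTI; apply: emeasurable_funB => //.
    exact/measurable_EFinP/measurable_birkhoff_sum.
  exact: emeasurable_itv.
have B0 : \bigcap_N B N = set0.
  apply/seteqP; split => // x Bx; have [Ex _] := Bx 0%N I.
  have [n [n0 nh]] := hE x Ex.
  have [_ /(_ n.-1)] := Bx n I; rewrite prednK// => /(_ (leqnn _)).
  by rewrite ltNge nh.
have muB0 : mu (B N) @[N --> \oo] --> 0.
  rewrite -(measure0 mu) -B0; apply: nonincreasing_cvg_mu => //.
  - by rewrite (le_lt_trans (probability_le1 _ _))// ltry.
  - by rewrite B0.
  - move=> m n mn; apply/subsetPset => x [Ex Bx]; split => // k km.
    exact/Bx/(leq_trans km).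
have main N : lam%:E * mu E <= \int[mu]_(x in E) (h x)%:E + lam%:E * mu (B N).
  pose h' x := (h x + lam * \1_(B N) x)%R.
  have mh' : measurable_fun setT h'.
    by apply: measurable_funD => //; apply: measurable_funM => //; exact: measurable_indic.
  have h'0 x : (0 <= h' x)%R by rewrite addr_ge0// mulr_ge0.
  have hh' x : (h x <= h' x)%R by rewrite lerDl mulr_ge0.
  have -> : \int[mu]_(x in E) (h x)%:E + lam%:E * mu (B N) = \int[mu]_(x in E) (h' x)%:E.
    under [in RHS]eq_integral do rewrite EFinD EFinM.
    rewrite ge0_integralD//; first last.
    - apply: measurable_funTS; apply/measurable_EFinP; apply: measurable_funM => //.
    - by move=> x _; rewrite -EFinM lee_fin mulr_ge0.
    - by apply: measurable_funTS; exact/measurable_EFinP.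
    - by move=> x _; rewrite lee_fin.
    congr (_ + _); rewrite ge0_integralZl_EFin//; first last.
    - by apply: measurable_funTS; apply/measurable_EFinP; exact: measurable_indic.
    by rewrite integral_indic// setIidl// => x [].
  (* Block lengths are bounded by N + 1 rather than N, so that the blocks of length one used on
     [B N] are allowed when N = 0. *)
  have blocks L x : E x -> ((L%:R - N.+1%:R) * lam <= S h' L x)%R.
    apply: birkhoff_sum_blocks => // [y Ey|y Ey]; first by rewrite -TE in Ey.
    have [yB|yB] := pselect (B N y).
      exists 1%N; split => //; rewrite birkhoff_sum1 mul1r /h' indicE mem_set// mulr1.
      by rewrite lerDr.
    have [n [nN nh]] : exists n, (n < N)%N /\ (n.+1%:R * lam <= S h n.+1 y)%R.
      apply: contrapT => H; apply: yB; split => // n nN.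
      by rewrite ltNge; apply/negP => nh; apply: H; exists n.
    exists n.+1; split; first by rewrite /= ltnS ltnW.
    by rewrite (le_trans nh)//; exact: birkhoff_sum_le.
  have blockI L : ((L.+1%:R - N.+1%:R) * lam)%:E * mu E <=
      L.+1%:R%:E * \int[mu]_(x in E) (h' x)%:E.
    rewrite -ge0_integral_birkhoff_sum//.
    have [LN|NL] := leqP N L; last first.
      apply: (@le_trans _ _ 0); last first.
        by apply: integral_ge0 => x _; rewrite lee_fin; exact: birkhoff_sum_ge0.
      rewrite mule_le0_ge0// lee_fin mulr_le0_ge0// subr_le0 ler_nat; exact: ltnW.
    rewrite -integral_cst//; apply: ge0_le_integral => //.
    - by move=> x _; rewrite lee_fin mulr_ge0// subr_ge0 ler_nat.
    - by apply: measurable_funTS; apply/measurable_EFinP; exact: measurable_birkhoff_sum.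
    - by move=> x Ex; rewrite lee_fin; exact: blocks.
  have muEfin : mu E \is a fin_num by exact: fin_num_measure.
  have I0 : 0 <= \int[mu]_(x in E) (h' x)%:E by apply: integral_ge0 => x _; rewrite lee_fin.
  move: blockI I0; rewrite -(fineK muEfin).
  case: (\int[mu]_(x in E) (h' x)%:E) => [r| |]//; last first.
    by move=> _ _; rewrite leey.
  move=> blockI r0; rewrite -EFinM lee_fin leNgt; apply/negP => rm.
  set m := fine (mu E) in blockI rm.
  (* The lost terms cost (N + 1) lam m once and for all, while the deficit L (lam m - r) grows with
     L; this [L] makes the deficit win. *)
  have /archi_boundP : (0 <= (N.+1%:R * (lam * m) + 1) / (lam * m - r))%R.
    by rewrite divr_ge0 ?subr_ge0 ?(ltW rm)// addr_ge0// mulr_ge0// (le_trans _ (ltW rm)).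
  set L := Num.bound _; rewrite ltr_pdivrMr ?subr_gt0// => bnd.
  have := blockI L; rewrite -!EFinM lee_fin => hL.
  by move: bnd hL rm; rewrite -!natr1; nra.
have [->|Ify] := eqVneq (\int[mu]_(x in E) (h x)%:E) +oo; first by rewrite leey.
have Ifin : \int[mu]_(x in E) (h x)%:E \is a fin_num.
  by rewrite ge0_fin_numE ?ltey//; apply: integral_ge0 => x _; rewrite lee_fin.
have C : \int[mu]_(x in E) (h x)%:E + lam%:E * mu (B N) @[N --> \oo] -->
    \int[mu]_(x in E) (h x)%:E.
  rewrite -[X in _ --> X]adde0 -[X in _ --> _ + X](mule0 lam%:E).
  apply: cvgeD; [by rewrite fin_num_adde_defr|exact: cvg_cst|exact: cvgeZl].
rewrite -(cvg_lim _ C)//; apply: lime_ge; first by apply/cvg_ex; eexists; exact: C.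
exact: nearW.
Qed.

Definition birkhoff_average (h : X -> R) n x : R := (n%:R^-1 * S h n x)%R.

Definition lower_average (h : X -> R) x : \bar R :=
  limn_einf (fun n => (birkhoff_average h n x)%:E).

Definition upper_average (h : X -> R) x : \bar R :=
  limn_esup (fun n => (birkhoff_average h n x)%:E).

Lemma birkhoff_sum_shift (h : X -> R) n x : S h n (T x) = (S h n.+1 x - h x)%R.
Proof. by rewrite -add1n birkhoff_sumD birkhoff_sum1 addrAC subrr add0r. Qed.

Lemma lower_average_invariant h x : lower_average h (T x) = lower_average h x.
Proof.
rewrite /lower_average -[RHS](limn_einf_average_shift _ (h x)).
by under eq_fun do rewrite /birkhoff_average birkhoff_sum_shift.
Qed.

Lemma upper_average_invariant h x : upper_average h (T x) = upper_average h x.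
Proof.
rewrite /upper_average -[RHS](limn_esup_average_shift _ (h x)).
by under eq_fun do rewrite /birkhoff_average birkhoff_sum_shift.
Qed.

Lemma measurable_birkhoff_average h n :
  measurable_fun setT h -> measurable_fun setT (birkhoff_average h n).
Proof. by move=> mh; apply: measurable_funM => //; exact: measurable_birkhoff_sum. Qed.

Lemma measurable_upper_average h :
  measurable_fun setT h -> measurable_fun setT (upper_average h).
Proof.
move=> mh; apply: measurable_fun_limn_esup => n.
exact/measurable_EFinP/measurable_birkhoff_average.
Qed.

Lemma measurable_lower_average h :
  measurable_fun setT h -> measurable_fun setT (lower_average h).
Proof.
move=> mh; apply: measurableT_comp => //; apply: measurable_fun_limn_esup => n.
by apply: measurableT_comp => //; exact/measurable_EFinP/measurable_birkhoff_average.
Qed.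

Lemma birkhoff_average_ge (h : X -> R) (a : R) n x :
  (0 < n)%N -> (forall y, a <= h y)%R -> (a <= birkhoff_average h n x)%R.
Proof.
move=> n0 ah; rewrite /birkhoff_average mulrC ler_pdivlMr ?ltr0n//.
rewrite (_ : a * n%:R = \sum_(k < n) a)%R; first exact: ler_sum.
by rewrite sumr_const card_ord mulr_natr.
Qed.

Lemma lower_average_ge (h : X -> R) (a : R) x :
  (forall y, a <= h y)%R -> a%:E <= lower_average h x.
Proof.
move=> ah; apply: limn_einf_ge_near.
by exists 1%N => // n /= n0; exact: birkhoff_average_ge.
Qed.

Lemma cvg_integral_truncation (E : set X) (h : X -> R) :
  measurable E -> measurable_fun setT h -> (forall x, (0 <= h x)%R) ->
  \int[mu]_(x in E) (Num.min (h x) K%:R)%:E @[K --> \oo] --> \int[mu]_(x in E) (h x)%:E.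
Proof.
move=> mE mh h0.
rewrite [X in _ --> X](_ : _ =
    \int[mu]_(x in E) limn (fun K : nat => (Num.min (h x) K%:R)%:E)); last first.
  apply: eq_integral => x _; apply/esym/cvg_lim => //; apply: cvg_near_cst.
  near=> K; congr EFin; apply/min_idPl; near: K; exact: nbhs_infty_ger.
apply: cvg_monotone_convergence => //.
- move=> K; apply: measurable_funTS; apply/measurable_EFinP.
  exact: measurable_minr.
- by move=> K x _; rewrite lee_fin le_min h0/=.
- move=> x _ m n mn.
  by rewrite lee_fin le_min ge_min lexx/= ge_min ler_nat mn orbT.
Unshelve. all: by end_near. Qed.

(** The maximal inequality bounds integrals from below, so it is applied to [K%:R - hK K] with
    threshold K - a. Truncation at K keeps this function nonnegative, and K then tends to
    infinity. *)
Lemma integral_le_of_lower_average_lt (E : set X) (h : X -> R) (a : R) :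
  measurable E -> T @^-1` E = E -> measurable_fun setT h -> (forall x, (0 <= h x)%R) ->
  (0 <= a)%R -> (forall x, E x -> lower_average h x < a%:E) ->
  \int[mu]_(x in E) (h x)%:E <= a%:E * mu E.
Proof.
move=> mE TE mh h0 a0 ha.
pose hK (K : nat) x := Num.min (h x) K%:R.
have mhK K : measurable_fun setT (hK K) by apply: measurable_minr.
have hK0 K x : (0 <= hK K x)%R by rewrite le_min h0/=.
have C := cvg_integral_truncation mE mh h0.
rewrite -(cvg_lim _ C)//; apply: lime_le; first by apply/cvg_ex; eexists; exact: C.
near=> K.
have aK : (a <= K%:R)%R by near: K; exact: nbhs_infty_ger.
have : (K%:R - a)%:E * mu E <= \int[mu]_(x in E) (K%:R - hK K x)%:E.
  apply: maximal_inequality => //.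
  - by apply: measurable_funB.
  - by move=> x; rewrite subr_ge0 ge_min lexx orbT.
  - by rewrite subr_ge0.
  - move=> x Ex; apply: contrapT => H.
    have := ha x Ex; apply/negP; rewrite -leNgt; apply: limn_einf_ge_near.
    exists 1%N => // n /= n0; rewrite /birkhoff_average mulrC ler_pdivlMr ?ltr0n// leNgt.
    apply/negP => hn; apply: H; exists n; split => //.
    rewrite /birkhoff_sum big_split/= sumrN sumr_const card_ord mulrBr mulr_natl.
    rewrite lerD2l lerN2 (le_trans (birkhoff_sum_le (h' := h) T n x _))//.
      by move=> y; rewrite ge_min lexx.
    by rewrite mulrC ltW.
have muEfin : mu E \is a fin_num by exact: fin_num_measure.
have mhKE : measurable_fun E (EFin \o hK K) by apply: measurable_funTS; exact/measurable_EFinP.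
have mKhKE : measurable_fun E (fun x => (K%:R - hK K x)%:E).
  by apply: measurable_funTS; apply/measurable_EFinP; exact: measurable_funB.
have KhK0 x : (0 <= K%:R - hK K x)%R by rewrite subr_ge0 ge_min lexx orbT.
have : \int[mu]_(x in E) (hK K x)%:E + \int[mu]_(x in E) (K%:R - hK K x)%:E = K%:R%:E * mu E.
  rewrite -ge0_integralD//; last 2 first.
  - by move=> x _; rewrite lee_fin.
  - by move=> x _; rewrite lee_fin.
  by rewrite -integral_cst//; apply: eq_integral => x _; rewrite -EFinD addrC subrK.
have : 0 <= \int[mu]_(x in E) (hK K x)%:E by apply: integral_ge0 => x _; rewrite lee_fin.
rewrite -(fineK muEfin).
case: (\int[mu]_(x in E) (hK K x)%:E) => [r| |]//; case: (\int[mu]_(x in E) _) => [s| |]//.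
rewrite -EFinD -!EFinM !lee_fin => _ -[]; lra.
Unshelve. all: by end_near. Qed.

(** A gap between the two averages contains rationals q < r. On the invariant set [E q r] the two
    inequalities give r mu(E) <= q mu(E), hence mu(E) = 0, and there are countably many pairs. *)
Lemma lower_upper_average_eq (h : X -> R) :
  measurable_fun setT h -> (forall x, (0 <= h x)%R) ->
  {ae mu, forall x, lower_average h x = upper_average h x}.
Proof.
move=> mh h0.
pose E (q r : rat) := [set x | lower_average h x < (ratr q)%:E] `&`
                      [set x | (ratr r)%:E < upper_average h x].
have mE q r : measurable (E q r).
  apply: measurableI; rewrite -[X in measurable X]setTI.
    by apply: emeasurable_fun_infty_o => //; exact: measurable_lower_average.
  by apply: emeasurable_fun_o_infty => //; exact: measurable_upper_average.
have TE q r : T @^-1` E q r = E q r.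
  apply/seteqP; split => x [];
  by rewrite /E /= ?lower_average_invariant ?upper_average_invariant.
have E0 (q r : rat) : (q < r)%R -> mu (E q r) = 0.
  move=> qr; have [q0|q0] := leP 0%R (ratr q : R); last first.
    rewrite (_ : E q r = set0) ?measure0//; apply/seteqP; split => // x [/= + _].
    by rewrite ltNge (le_trans _ (lower_average_ge _ h0))// lee_fin ltW.
  have le1 := integral_le_of_lower_average_lt (mE q r) (TE q r) mh h0 q0 (fun x Ex => Ex.1).
  have r0 : (0 <= ratr r :> R)%R by rewrite (le_trans q0)// ler_rat ltW.
  have le2 : (ratr r)%:E * mu (E q r) <= \int[mu]_(x in E q r) (h x)%:E.
    apply: maximal_inequality => // x [_ /= Ex]; apply: contrapT => H.
    move: Ex; apply/negP; rewrite -leNgt; apply: limn_esup_le_near.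
    exists 1%N => // n /= n0; rewrite /birkhoff_average mulrC ler_pdivrMr ?ltr0n// leNgt.
    apply/negP => hn; apply: H; exists n; split => //.
    by rewrite mulrC ltW.
  have muEfin : mu (E q r) \is a fin_num by exact: fin_num_measure.
  have m0 : (0 <= fine (mu (E q r)))%R by rewrite fine_ge0.
  have := le_trans le2 le1.
  have mE' := fineK muEfin; move: m0 mE'; move: (fine _) => m m0 <-.
  rewrite -!EFinM !lee_fin => h1.
  congr EFin; apply/eqP; rewrite eq_le m0 andbT leNgt; apply/negP => mp.
  by move: h1; rewrite ler_pM2r// ler_rat leNgt qr.
have : \forall x \ae mu, forall n,
    if (unpickle n : option (rat * rat)) is Some (q, r)
    then (q < r)%R -> ~ E q r x else True.
  apply: ae_foralln => n; case: (unpickle n) => [[q r]|]; last exact: aeW.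
  have [qr|_] := ltP q r; last exact: aeW.
  exists (E q r); split => // [|x /= H]; first exact: E0.
  by apply: contrapT => nE; exact: H.
apply: filterS => x H; apply/eqP; rewrite eq_le limn_einf_sup/= leNgt; apply/negP => lu.
have [q /andP[lq /lte_rat_between[r /andP[qr ru]]]] := lte_rat_between lu.
have := H (pickle (q, r)); rewrite pickleK; apply => //.
by move: qr; rewrite lte_fin ltr_rat.
Qed.

Theorem birkhoff_real (h : X -> R) :
  measurable_fun setT h -> (forall x, (0 <= h x)%R) ->
  {ae mu, forall x, (birkhoff_average h n x)%:E @[n --> \oo] --> lower_average h x}.
Proof.
move=> mh h0; have := lower_upper_average_eq mh h0.
by apply: filterS => x /limn_einf_esup_cvg.
Qed.

Lemma integral_birkhoff_average (h : X -> R) n :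
  measurable_fun setT h -> (forall x, (0 <= h x)%R) -> (0 < n)%N ->
  \int[mu]_x (birkhoff_average h n x)%:E = \int[mu]_x (h x)%:E.
Proof.
move=> mh h0 n0; under eq_integral do rewrite EFinM.
rewrite ge0_integralZl_EFin//; first last.
- by apply/measurable_EFinP; exact: measurable_birkhoff_sum.
- by move=> x _; rewrite lee_fin; exact: birkhoff_sum_ge0.
rewrite ge0_integral_birkhoff_sum// muleA -EFinM mulVf ?mul1e//.
by rewrite pnatr_eq0 -lt0n.
Qed.

(** Fatou's lemma gives one inequality. For the other, the averages of a truncation are bounded, so
    dominated convergence yields equality for it; truncating lowers the limit, while the truncated
    integral tends to that of [h]. *)
Lemma integral_lower_average (h : X -> R) :
  measurable_fun setT h -> (forall x, (0 <= h x)%R) ->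
  \int[mu]_x lower_average h x = \int[mu]_x (h x)%:E.
Proof.
move=> mh h0; apply/eqP; rewrite eq_le; apply/andP; split.
  apply: (@le_trans _ _ (limn_einf (fun n => \int[mu]_x (birkhoff_average h n x)%:E))).
    apply: fatou => //.
    - by move=> n; apply/measurable_EFinP; exact: measurable_birkhoff_average.
    - by move=> n x _; rewrite lee_fin mulr_ge0//; exact: birkhoff_sum_ge0.
  have /cvg_limn_einf_sup[->//] : \int[mu]_x (birkhoff_average h n x)%:E @[n --> \oo] -->
      \int[mu]_x (h x)%:E.
    apply: cvg_near_cst; exists 1%N => // n /= n0.
    exact: integral_birkhoff_average.
pose hK (K : nat) x := Num.min (h x) K%:R.
have mhK K : measurable_fun setT (hK K) by apply: measurable_minr.
have hK0 K x : (0 <= hK K x)%R by rewrite le_min h0/=.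
have C := cvg_integral_truncation measurableT mh h0.
rewrite -(cvg_lim _ C)//; apply: lime_le; first by apply/cvg_ex; eexists; exact: C.
apply: nearW => K.
have [_ _ D] : [/\ mu.-integrable setT (lower_average (hK K)),
  [sequence \int[mu]_x `|(birkhoff_average (hK K) n x)%:E - lower_average (hK K) x| ]_n
     @ \oo --> 0 &
  [sequence \int[mu]_x (birkhoff_average (hK K) n x)%:E ]_n @ \oo -->
     \int[mu]_x lower_average (hK K) x].
  apply: (@dominated_convergence _ _ _ mu setT measurableT _ _ (cst K%:R%:E)).
  - by move=> n; apply/measurable_EFinP; exact: measurable_birkhoff_average.
  - exact: measurable_lower_average.
  - by have := birkhoff_real (mhK K) (hK0 K); apply: filterS => x.
  - exact: finite_measure_integrable_cst.
  - apply: aeW => x n _; rewrite gee0_abs ?lee_fin; last first.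
      by rewrite mulr_ge0//; exact: birkhoff_sum_ge0.
    rewrite /birkhoff_average; case: n => [|n]; first by rewrite invr0 mul0r.
    rewrite mulrC ler_pdivrMr ?ltr0n//.
    rewrite (_ : K%:R * n.+1%:R = \sum_(k < n.+1) K%:R)%R.
      by apply: ler_sum => k _; rewrite ge_min lexx orbT.
    by rewrite sumr_const card_ord mulr_natr.
have -> : \int[mu]_x (hK K x)%:E = \int[mu]_x lower_average (hK K) x.
  rewrite -(cvg_lim _ D)//; apply/esym/cvg_lim => //.
  apply: cvg_near_cst; exists 1%N => // n /= n0.
  exact: integral_birkhoff_average.
apply: ge0_le_integral => //.
- by move=> x _; exact: lower_average_ge.
- exact: measurable_lower_average.
- exact: measurable_lower_average.
- move=> x _; rewrite /lower_average !limn_einf_lim.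
  apply: lee_lim; [exact: is_cvg_einfs|exact: is_cvg_einfs|].
  apply: nearW => n; apply: le_ereal_inf_tmp => _ [m /= nm <-].
  apply: le_trans; first by apply: ereal_inf_lbound; exists m.
  rewrite lee_fin ler_wpM2l//; apply: birkhoff_sum_le => y.
  by rewrite ge_min lexx.
Unshelve. all: by end_near. Qed.

End measure_preserving.

(** * Ergodic theorem for nonnegative functions with infinite values *)

Section birkhoff_extended.
Context d (X : measurableType d) (R : realType) (mu : probability X R).
Variable T : X -> X.
Hypothesis mT : measurable_fun setT T.
Hypothesis invT : forall B, measurable B -> mu (T @^-1` B) = mu B.
Local Open Scope ereal_scope.

Lemma ge0_integral_eqy (f : X -> \bar R) (A : set X) :
  measurable A -> measurable_fun setT f -> (forall x, 0 <= f x) ->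
  (forall x, A x -> f x = +oo) -> mu A != 0 -> \int[mu]_x f x = +oo.
Proof.
move=> mA mf f0 fA muA; apply/eqP; rewrite -leye_eq.
apply: (@le_trans _ _ (\int[mu]_(x in A) f x)); last exact: ge0_subset_integral.
rewrite (eq_integral (cst +oo)); last by move=> x /[!inE] /fA.
by rewrite integral_cst// gt0_mulye// lt0e muA/=.
Qed.

Lemma measure_preimage_iter B n : measurable B -> mu (iter n T @^-1` B) = mu B.
Proof.
move=> mB; elim: n => // n IH; rewrite -IH -(invT (_ : measurable (iter n T @^-1` B))).
  by congr (mu _); apply/seteqP; split => x; rewrite /preimage/= -iterS iterSr.
by rewrite -[X in measurable X]setTI; exact: (measurable_iter mT).
Qed.

(* Where [h] is infinite the invariant set of the points visiting [h = +oo]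
   infinitely often is used, since it is exactly invariant. *)
Theorem birkhoff_ge0 (h : X -> \bar R) :
  measurable_fun setT h -> (forall x, 0 <= h x) ->
  exists hs : X -> \bar R, [/\ measurable_fun setT hs, (forall x, 0 <= hs x),
    (forall x, hs (T x) = hs x),
    {ae mu, forall x, n%:R^-1%:E * \sum_(k < n) h (iter k T x) @[n --> \oo] --> hs x} &
    \int[mu]_x hs x = \int[mu]_x h x].
Proof.
move=> mh h0.
(* [fine] turns +oo into 0; up to a null set, the averages of [g] matter only on orbits that avoid
   [H]. *)
pose g x := fine (h x).
have mg : measurable_fun setT g by exact: measurableT_comp.
have g0 x : (0 <= g x)%R by rewrite fine_ge0.
pose H := h @^-1` [set +oo].
have mH : measurable H by rewrite -[X in measurable X]setTI; exact: mh.
pose D n := \bigcup_(k in [set k | (n <= k)%N]) (iter k T @^-1` H).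
have mHk k : measurable (iter k T @^-1` H).
  by rewrite -[X in measurable X]setTI; exact: (measurable_iter mT).
have mD n : measurable (D n) by apply: bigcup_measurable => k _.
have TD n : T @^-1` D n = D n.+1.
  apply/seteqP; split => x [k /= nk hk].
    by exists k.+1 => //; rewrite /preimage/= -iterS iterSr.
  case: k nk hk => // k nk hk; exists k => //.
  by move: hk; rewrite /preimage/= -iterS iterSr.
have DS n : D n.+1 `<=` D n by move=> x [k /= nk hk]; exists k => //; exact: ltnW.
(* As in Poincare recurrence: the sets [D n] decrease with constant measure, so almost every point
   that visits [H] does so infinitely often. *)
have muD n : mu (D n) = mu (D 0%N) by elim: n => // n IH; rewrite -TD invT.
pose Dy := \bigcap_n D n.
have mDy : measurable Dy by exact: bigcapT_measurable.
have TDy : T @^-1` Dy = Dy.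
  apply/seteqP; split => x Dx n _.
    by apply: DS; rewrite -TD; exact: Dx.
  have : D n.+1 x by exact: Dx.
  by rewrite -TD.
have D0y : {ae mu, forall x, D 0%N x -> Dy x}.
  have : \forall x \ae mu, forall n, D 0%N x -> D n x.
    apply: ae_foralln => n; exists (D 0%N `\` D n); split; first exact: measurableD.
      rewrite measureD//= ?setIidr ?muD ?subee//.
      - exact: fin_num_measure.
      - by elim: n => // n IH; apply: subset_trans IH.
      - by rewrite (le_lt_trans (probability_le1 _ _))// ltry.
    by move=> x /not_implyP[].
  by apply: filterS => x Hx D0x n _; exact: Hx.
pose hs x := if x \in Dy then +oo else lower_average T g x.
have hs0 x : 0 <= hs x by rewrite /hs; case: ifP => // _; exact: lower_average_ge.
have mhs : measurable_fun setT hs.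
  apply: measurable_fun_ifT => //; last exact: (measurable_lower_average mT).
  by apply: (measurable_fun_bool true); rewrite setTI (_ : _ @^-1` _ = Dy)//;
    apply/seteqP; split => x /= => [/set_mem|/mem_set].
exists hs; split => //.
- move=> x; rewrite /hs lower_average_invariant.
  rewrite (_ : (T x \in Dy) = (x \in Dy))//.
  by rewrite -[in RHS]TDy; apply/idP/idP => /set_mem H'; exact/mem_set.
- have := birkhoff_real mT invT mg g0.
  move: D0y; apply: filterS2 => x D0y cvgx.
  have [D0x|nD0x] := pselect (D 0%N x).
    rewrite /hs mem_set; last exact: D0y.
    have [k _ hk] := D0x.
    apply: cvg_near_cst; exists k.+1 => // n /= kn.
    have -> : \sum_(i < n) h (iter i T x) = +oo.
      apply/eqP; rewrite -leye_eq -[leLHS]hk (bigD1 (Ordinal kn))//= leeDl//.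
      by apply: sume_ge0.
    by rewrite gt0_muley// lte_fin invr_gt0 ltr0n (leq_trans _ kn).
  rewrite /hs memNset; last by move=> Dyx; apply: nD0x; exact: Dyx.
  rewrite (_ : (fun n => _) = (fun n => (birkhoff_average T g n x)%:E))//.
  apply/funext => n.
  rewrite /birkhoff_average EFinM /birkhoff_sum -sumEFin; congr (_ * _).
  apply: eq_bigr => k _; rewrite /g fineK// ge0_fin_numE// ltey; apply/eqP => hk.
  by apply: nD0x; exists k.
(* If [H] has positive measure, so has [Dy], and both integrals are +oo; otherwise almost no orbit
   meets [H] and the real-valued case applies. *)
have [muH|muH] := eqVneq (mu H) 0; last first.
  rewrite (ge0_integral_eqy mH mh h0)//.
  apply: (ge0_integral_eqy mDy mhs hs0); first by move=> x Dx; rewrite /hs mem_set.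
  have muDy : mu (D 0%N) <= mu Dy.
    have muDDy : mu (D 0%N `\` Dy) = 0.
      apply/negligibleP; first exact: measurableD.
      move: D0y => [N [mN N0 DN]]; exists N; split => //.
      by move=> x [D0x nDx]; apply: DN => /= /(_ D0x).
    rewrite -[leRHS]adde0 -[X in _ + X]muDDy -measureU//; first last.
    - by apply/seteqP; split => // x [Dx [_ /(_ Dx)]].
    - exact: measurableD.
    apply: le_measure; rewrite ?inE//; first by apply: measurableU => //; exact: measurableD.
    by move=> x D0x; have [Dx|nDx] := pselect (Dy x); [left|right].
  rewrite gt_eqF// (lt_le_trans _ muDy)// (@lt_le_trans _ _ (mu H))//.
    by rewrite lt0e muH/=.
  by apply: le_measure; rewrite ?inE// => x Hx; exists 0%N.
have nD0 : {ae mu, forall x, ~ D 0%N x}.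
  have : \forall x \ae mu, forall k, ~ H (iter k T x).
    apply: ae_foralln => k; exists (iter k T @^-1` H); split => //.
      exact: (etrans (measure_preimage_iter k mH)).
    by move=> x /= /contrapT.
  by apply: filterS => x Hx [k _]; exact: Hx.
transitivity (\int[mu]_x lower_average T g x).
  apply: ae_eq_integral => //; first exact: (measurable_lower_average mT).
  move: nD0; apply: filterS => x nD0x _; rewrite /hs memNset// => Dyx.
  by apply: nD0x; exact: Dyx.
rewrite (integral_lower_average mT invT)//.
apply: ae_eq_integral => //; first exact/measurable_EFinP.
move: nD0; apply: filterS => x nD0x _; rewrite /g fineK// ge0_fin_numE// ltey.
by apply/eqP => hx; apply: nD0x; exists 0%N.
Qed.

End birkhoff_extended.

(** * Continuity and differentiability relative to a set *)

Section within_continuity.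
Variable R : realType.
Local Notation plane := (R * R)%type.

Let box (q : (rat * rat) * (rat * rat)) : set plane :=
  `]ratr q.1.1, ratr q.1.2[ `*` `]ratr q.2.1, ratr q.2.2[.

Lemma nbhs_rational_box (z : plane) (N : set plane) :
  nbhs z N -> exists2 q, box q z & box q `<=` N.
Proof.
move=> [[A B] /= [Az Bz] ABN].
have side (x : R) (C : set R) : nbhs x C -> exists2 q : rat * rat,
    (ratr q.1 < x < ratr q.2) & `]ratr q.1, ratr q.2[ `<=` C.
  move=> /nbhs_ballP[e /= e0 eC].
  have /rat_in_itvoo[a] : x - e < x by rewrite gtrBl.
  have /rat_in_itvoo[b] : x < x + e by rewrite ltrDl.
  rewrite !in_itv/= => /andP[xb be] /andP[ea ax].
  exists (a, b) => /=; first by rewrite ax xb.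
  move=> y; rewrite /= in_itv/= => /andP[ay yb]; apply: eC.
  by rewrite /ball/= ltr_norml; lra.
have [p pz pA] := side _ _ Az; have [q qz qB] := side _ _ Bz.
exists (p, q); first by split; rewrite /= in_itv.
by move=> y [/pA y1 /qB y2]; exact: ABN.
Qed.

(** The preimage of an open half-line is the trace on [D] of the union of the rational boxes in [W],
    a countable union. *)
Lemma within_cvg_measurable_fun (D : set plane) (h : plane -> R) :
  measurable D -> (forall z, D z -> h u @[u --> within D (nbhs z)] --> h z) ->
  measurable_fun D h.
Proof.
move=> mD hD; apply: (measurability _ (RGenOInfty.measurableE R)).
move=> _ [_ [a ->] <-].
pose W := [set q | D `&` box q `<=` h @^-1` `]a, +oo[ ].
rewrite (_ : D `&` _ = D `&` \bigcup_q (if q \in W then box q else set0)).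
  apply: measurableI => //; apply: countable_bigcupT_measurable => //.
  move=> q; case: ifP => // _; apply: measurableX; exact: measurable_itv.
apply/seteqP; split => z [Dz].
  move=> /= az; split => //.
  have : nbhs (h z) `]a, +oo[%classic.
    by apply: open_nbhs_nbhs; split => //; exact: interval_open.
  move=> /(hD _ Dz); rewrite nbhs_simpl => /nbhs_rational_box[q qz qW].
  exists q => //; rewrite mem_set// => y [Dy qy]; exact: qW.
move=> [q _]; case: ifPn => // /set_mem qW qz; split => //.
exact: qW.
Qed.

Lemma locally_hoelder_within {V : normedModType R} (A : set V) (h : V -> R) x :
  locally_hoelder A h -> A x -> h u @[u --> within A (nbhs x)] --> h x.
Proof.
move=> hA Ax; have [U [C [a [Ux /andP[a0 _] hU]]]] := hA x Ax.
apply/cvgrPdist_lt => e e0; rewrite near_withinE.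
have [C0|C0] := leP C 0.
  near=> u => Au; apply: le_lt_trans e0.
  rewrite (le_trans (hU x u Ax Au _ _))//; [exact: nbhs_singleton|by near: u|].
  by rewrite mulr_le0_ge0// powR_ge0.
near=> u => Au.
rewrite (le_lt_trans (hU x u Ax Au _ _))//; [exact: nbhs_singleton|by near: u|].
(* The distance to [x] has to be less than (C^-1 e)^(1/a), whose power a is C^-1 e. *)
rewrite -ltr_pdivlMl// [ltRHS](_ : _ = ((C^-1 * e) `^ a^-1) `^ a); last first.
  by rewrite -powRrM mulVf ?gt_eqF// powRr1// mulr_ge0// ?invr_ge0 ltW.
apply: gt0_ltr_powR => //; rewrite ?nnegrE ?powR_ge0//.
near: u; apply: (@cvgr_dist_lt _ _ _ _ _ id) => //.
by rewrite powR_gt0// mulr_gt0// invr_gt0.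
Unshelve. all: by end_near. Qed.

Lemma derivable_on_within (A : set R) (f : R -> R) x :
  derivable_on A f x -> A x -> f u @[u --> within A (nbhs x)] --> f x.
Proof.
move=> /cvgrPdist_lt/(_ 1 ltr01); rewrite near_withinE => fA Ax.
set l := lim _ in fA.
have : \forall u \near x, A u -> `|f u - f x| <= (`|l| + 1) * `|u - x|.
  move: fA; rewrite near_withinE => /nbhs_ballP[e /= e0 fA].
  apply/nbhs_ballP; exists e => // u xu Au.
  have [->|ux] := eqVneq u x; first by rewrite subrr normr0 mulr_ge0// addr_ge0.
  have ux0 : u - x != 0 by rewrite subr_eq0.
  have := fA (u - x); rewrite /ball/= sub0r normrN distrC => /(_ xu ux0).
  rewrite [x + _]addrC subrK => /(_ Au) lq.
  have -> : f u - f x = ((u - x)^-1 * (f u - f x)) * (u - x) by rewrite mulrAC mulVf ?mul1r.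
  rewrite normrM [`|x - u|]distrC; apply: ler_wpM2r => //.
  by move: lq; move: (_ * _) => q lq; rewrite -[q](subrK l) (le_trans (ler_normD _ _))//
    addrC lerD2l distrC ltW.
move=> lip; apply/cvgrPdist_lt => e e0; rewrite near_withinE.
near=> u => Au; rewrite distrC.
apply: (@le_lt_trans _ _ ((`|l| + 1) * `|u - x|)).
  by move: Au; near: u.
rewrite -ltr_pdivlMl ?ltr_wpDl// distrC.
near: u; apply: (@cvgr_dist_lt _ _ _ _ _ id) => //.
by rewrite mulr_gt0// invr_gt0 ltr_wpDl.
Unshelve. all: by end_near. Qed.

Lemma derive_on_interior (A : set R) (f : R -> R) x :
  nbhs x A -> derivable_on A f x -> is_derive x 1 f (derive_on A f x).
Proof.
move=> Ax fA.
have : h^-1 *: (f (h *: 1 + x) - f x) @[h --> 0^'] --> derive_on A f x.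
  move=> B /fA; rewrite !nbhs_simpl/= => /= qB.
  have A0 : \forall h \near 0^', A (x + h).
    move: Ax => /nbhs_ballP[e /= e0 xA]; apply/nbhs_ballP; exists e => // h.
    rewrite /ball/= sub0r normrN => he _; apply: xA.
    by rewrite /ball/= opprD addrA subrr sub0r normrN.
  have {}qB : \forall h \near 0^', A (x + h) -> B (h^-1 * (f (x + h) - f x)) by exact: qB.
  near=> h.
  rewrite /= [h *: 1]mulr1 [h + x]addrC.
  have Ah : A (x + h) by near: h.
  by move: Ah; near: h.
move=> C; apply: DeriveDef; first by apply/cvg_ex; eexists; exact: C.
exact: cvg_lim C.
Unshelve. all: by end_near. Qed.

(** At points strictly between x and y the relative derivative is the ordinary one, and at the ends
    the mean value theorem asks only for continuity relative to [x, y]; the values of [f] outside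
    [a, b] never enter. *)
Lemma derive_on_itv_lipschitz (a b : R) (f : R -> R) (k : R) :
  (forall x, a <= x <= b -> derivable_on `[a, b] f x) ->
  (forall x, a <= x <= b -> `|derive_on `[a, b] f x| <= k) ->
  forall x y, a <= x <= b -> a <= y <= b -> `|f x - f y| <= k * `|x - y|.
Proof.
move=> fd fk x y; wlog xy : x y / x <= y.
  move=> H xab yab; have [xy|/ltW yx] := leP x y; first exact: H.
  by rewrite distrC [`|x - y|]distrC; exact: H.
move=> /andP[ax xb] /andP[ay yb].
have [||c] := @MVT_segment R f (derive_on `[a, b] f) x y xy.
- move=> u; rewrite in_itv/= => /andP[xu uy]; apply: derive_on_interior.
    apply: (@filterS _ _ _ `]x, y[%classic).
      by move=> v; rewrite /= !in_itv/= => /andP[? ?]; lra.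
    by apply: open_nbhs_nbhs; split; [exact: interval_open|rewrite /= in_itv/= xu].
  by apply: fd; lra.
- apply/subspace_continuousP => u; rewrite /= in_itv/= => /andP[xu uy].
  have uab : `[a, b]%classic u by rewrite /= in_itv/=; lra.
  have := derivable_on_within (fd u ltac:(lra)) uab.
  apply: cvg_trans; apply: cvg_app; apply: within_subset.
  by move=> v; rewrite /= !in_itv/= => /andP[? ?]; lra.
- rewrite in_itv/= => /andP[xc cy] e.
  rewrite distrC e normrM [`|x - y|]distrC; apply: ler_wpM2r => //.
  by apply: fk; lra.
Qed.

End within_continuity.

(** * Sets of full measure and averages *)

Section full_measure.
Context d (X : measurableType d) (R : realType) (mu : probability X R).
Local Open Scope ereal_scope.

Lemma measureI_full (A S : set X) :
  measurable A -> measurable S -> mu (~` S) = 0 -> mu (A `&` S) = mu A.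
Proof.
move=> mA mS muS; rewrite [RHS](measureDI _ mA mS) [X in X + _](_ : _ = 0) ?add0e//.
have mSC : measurable (~` S) by exact: measurableC.
apply: (subset_measure0 (B := ~` S)) => //; exact: measurableD.
Qed.

Import HBNNSimple.

(* No measurability of [u] and [v]: the integrals to compare are over the
   attractor, which is only known to contain a measurable set of full measure. *)
Lemma eq_integral_full (A : set X) (u v : X -> \bar R) :
  measurable A -> mu (~` A) = 0 -> (forall x, A x -> u x = v x) ->
  \int[mu]_x u x = \int[mu]_x v x.
Proof.
move=> mA muA uv.
have le (p q : X -> \bar R) : (forall x, 0 <= p x) -> (forall x, 0 <= q x) ->
    (forall x, A x -> p x = q x) -> \int[mu]_x p x <= \int[mu]_x q x.
  move=> p0 q0 pq; rewrite !ge0_integralTE//.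
  apply: ge_ereal_sup => _ [k kp <-].
  rewrite -integralT_nnsfun.
  rewrite (ae_eq_integral (EFin \o proj_nnsfun k mA)) //.
  - rewrite integralT_nnsfun; apply: ereal_sup_ubound; exists (proj_nnsfun k mA) => // x.
    rewrite /= mindicE; have [Ax|nAx] := boolP (x \in A).
      by rewrite mulr1 -pq ?kp// -inE.
    by rewrite mulr0.
  - exact/measurable_EFinP.
  - by apply/measurable_EFinP; exact: measurable_funP.
  - exists (~` A); split => //; first exact: measurableC.
    move=> x /= H Ax; apply: H => _.
    by rewrite mindicE mem_set// mulr1.
have eq (p q : X -> \bar R) : (forall x, 0 <= p x) -> (forall x, 0 <= q x) ->
    (forall x, A x -> p x = q x) -> \int[mu]_x p x = \int[mu]_x q x.
  move=> p0 q0 pq; apply/eqP; rewrite eq_le !le// => x /pq //.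
rewrite integralE [RHS]integralE; congr (_ - _); apply: eq => // x Ax.
  by rewrite !funeposE uv.
by rewrite !funenegE uv.
Qed.

(** Almost everywhere [hs] equals the infimum [kappa] of the rational levels whose sublevel set has
    full measure; on a probability space the constant [kappa], possibly infinite, is its own
    integral. *)
Lemma ae_eq_integral_of_01 (hs : X -> \bar R) :
  measurable_fun setT hs ->
  (forall q : rat, mu [set x | hs x < (ratr q)%:E] = 0 \/
                   mu [set x | hs x < (ratr q)%:E] = 1) ->
  {ae mu, forall x, hs x = \int[mu]_y hs y}.
Proof.
move=> mhs h01.
pose A (q : rat) := [set x | hs x < (ratr q)%:E].
have mA q : measurable (A q).
  by rewrite -[X in measurable X]setTI; exact: emeasurable_fun_infty_o.
pose kappa : \bar R := ereal_inf [set (ratr q)%:E | q in [set q | mu (A q) = 1]].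
have hk : {ae mu, forall x, hs x = kappa}.
  have : \forall x \ae mu, forall n,
      if (unpickle n : option rat) is Some q
      then (mu (A q) = 1 <-> A q x) else True.
    apply: ae_foralln => n; case: (unpickle n) => [q|]; last exact: aeW.
    have [q0|q1] := h01 q.
      exists (A q); split => // x /= H; apply: contrapT => nA; apply: H.
      by split => //; rewrite -/(A q) in q0; rewrite q0 => /eqP; rewrite eq_sym onee_eq0.
    have q1C : mu (~` A q) = 0 by rewrite probability_setC// q1 subee.
    exists (~` A q); split => //; first exact: measurableC.
    by move=> x /= H Ax; apply: H.
  apply: filterS => x H; have {}H q : mu (A q) = 1 <-> A q x.
    by have := H (pickle q); rewrite pickleK.
  apply/eqP; rewrite eq_le; apply/andP; split.
    by apply: le_ereal_inf_tmp => _ [q /= /H/ltW ? <-].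
  rewrite leNgt; apply/negP => /lte_rat_between[q /andP[/H Aq]].
  by apply/negP; rewrite -leNgt; apply: ereal_inf_lbound; exists q.
have -> : \int[mu]_y hs y = kappa.
  rewrite (ae_eq_integral (cst kappa))//; last by apply: filterS hk => x.
  by rewrite integral_cst// -[RHS]mule1 -(probability_setT mu).
exact: hk.
Qed.

End full_measure.

(** * Extended logarithms and averages *)

Section growth.
Variable R : realType.
Local Open Scope ereal_scope.

(** With log 0 = -oo the product rule extends to zero factors: the logarithm of a real number is
    never +oo, so no indeterminate sum arises. *)
Lemma lneM_ge0 (a b : R) : (0 <= a)%R -> (0 <= b)%R ->
  lne (a * b)%:E = lne a%:E + lne b%:E.
Proof.
rewrite le_eqVlt => /predU1P[<- _|a0].
  by rewrite mul0r le0_lneNy.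
rewrite le_eqVlt => /predU1P[<-|b0].
  by rewrite mulr0 le0_lneNy// addeNy.
by rewrite EFinM lneM// in_itv/= lte_fin ?a0 ?b0 leey.
Qed.

Lemma le_lne (a b : R) : (0 <= a)%R -> (a <= b)%R -> lne a%:E <= lne b%:E.
Proof.
move=> a0 ab; rewrite lee_lne ?lee_fin// in_itv/= lee_fin ?a0 ?(le_trans a0 ab) leey//.
Qed.

Lemma measurable_lne_norm d (X : measurableType d) (D : set X) (h : X -> R) :
  measurable D -> measurable_fun D h ->
  measurable_fun D (fun x => lne (`|h x|)%:E).
Proof.
move=> mD mh.
have -> : (fun x => lne (`|h x|)%:E) =
    (fun x => if h x == 0%R then -oo else (ln `|h x|)%:E).
  apply/funext => x; case: ifPn => [/eqP ->|h0]; first by rewrite normr0 le0_lneNy.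
  by rewrite lne_EFin// normr_gt0.
apply: measurable_fun_if => //.
- apply: (measurable_fun_bool true).
  rewrite (_ : _ @^-1` _ = h @^-1` [set 0%R]); first exact: mh.
  by apply/seteqP; split => x /= /eqP.
- apply/measurable_EFinP; apply: (@measurable_funS _ _ _ _ D) => //.
  apply: measurableT_comp => //; exact: measurableT_comp.
Qed.

(** The constant stands for the size of the initial vector or of a cone. Its average is finite and
    tends to 0, so the sum of the limits is defined even for infinite [l]. *)
Lemma average_shift_cvg (c : R) (S : (\bar R)^nat) (l : \bar R) :
  n%:R^-1%:E * S n @[n --> \oo] --> l -> n%:R^-1%:E * (c%:E + S n) @[n --> \oo] --> l.
Proof.
move=> Sl; rewrite -[l]add0e.
under eq_fun do rewrite muleDr ?fin_num_adde_defr//.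
apply: cvgeD => //.
have : (n%:R^-1 * c)%R @[n --> \oo] --> (0 * c)%R.
  by apply: cvgMl; rewrite -cvg_shiftS; exact: cvg_harmonic.
by rewrite mul0r => nc; apply: cvg_EFin; [exact: nearW|exact: nc].
Qed.

End growth.

(** * The map F and its invariant measures *)

Section lorenz.
Variables (R : realType) (f : R -> R) (g : R -> R -> R).
Variables (yp ym vl vr rho M : R) (b : bool).
Hypothesis FL : lorenz_like f g yp ym vl vr rho M.
Local Notation plane := (R * R)%type.
Local Notation F := (F_map f g yp ym b).
Local Notation square := (@square R).
Local Notation dom_f := (@dom_f R).
Local Notation dom_F := (@dom_F R).

Lemma dom_fP (x : R) : dom_f x <-> -1 <= x <= 1 /\ x != 0.
Proof.
rewrite /Defs.dom_f; split.
  move=> []; rewrite /= in_itv/= => /andP[? ?].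
    by split; [lra|rewrite lt_eqF].
  by split; [lra|rewrite gt_eqF].
move=> [/andP[x1 x2]]; rewrite neq_lt => /orP[x0|x0]; [left|right];
  by rewrite /= in_itv/= ?x1 ?x2 x0.
Qed.

Lemma dom_FP (z : plane) : dom_F z <-> square z /\ z.1 != 0.
Proof.
rewrite /Defs.dom_F /Defs.square; split.
  by move=> [/dom_fP[z1 z0] z2]; split => //; split => //=; rewrite in_itv.
by move=> [[z1 z2] z0]; split => //; apply/dom_fP; split => //; rewrite /= in_itv in z1.
Qed.

Lemma F_map_step z : square z -> F_step f g yp ym z (F z).
Proof.
move=> zS; rewrite /F_step /F_map; have [z0|z0] := eqVneq z.1 0.
  by right; split => //; split => //; case: (b); [left|right].
by left; split => //; apply/dom_FP.
Qed.

Lemma F_map_square z : square z -> square (F z).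
Proof.
move=> zS; have [+ _] := ll_F_into FL; apply.
by exists z => //; exact: F_map_step.
Qed.

Lemma measurable_square : measurable square.
Proof. by apply: measurableX; exact: measurable_itv. Qed.

Lemma measurable_dom_F : measurable dom_F.
Proof.
by apply: measurableX; [apply: measurableU|]; exact: measurable_itv.
Qed.

Lemma within_fst (h : R -> R) :
  (forall x, dom_f x -> h u @[u --> within dom_f (nbhs x)] --> h x) ->
  forall z, dom_F z -> h u.1 @[u --> within dom_F (nbhs z)] --> h z.1.
Proof.
move=> hx [x y] [/= dx dy] B /(hx x dx); rewrite !nbhs_simpl/= => hB.
have : \forall u \near (x, y), dom_f u.1 -> B (h u.1).
  exact: (@cvg_fst _ _ (nbhs x) (nbhs y) _ _ hB).
by apply: filterS => u uB [/= /uB].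
Qed.

Lemma measurable_f : measurable_fun dom_F (fun z => f z.1).
Proof.
apply: within_cvg_measurable_fun; first exact: measurable_dom_F.
apply: within_fst => x dx; apply: derivable_on_within => //.
exact: ll_f_derivable FL _ dx.
Qed.

Lemma measurable_df : measurable_fun dom_F (fun z => df f z.1).
Proof.
apply: within_cvg_measurable_fun; first exact: measurable_dom_F.
apply: within_fst => x dx; apply: locally_hoelder_within => //.
exact: ll_f_hoelder FL.
Qed.

Lemma measurable_dg_y : measurable_fun dom_F (dg_y g).
Proof.
apply: within_cvg_measurable_fun; first exact: measurable_dom_F.
by move=> z dz; apply: locally_hoelder_within => //; exact: ll_gy_hoelder FL.
Qed.

Lemma g_lipschitz x y y' : dom_f x -> -1 <= y <= 1 -> -1 <= y' <= 1 ->
  `|g x y - g x y'| <= 2^-1 * `|y - y'|.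
Proof.
move=> dx; apply: derive_on_itv_lipschitz => u u1.
  by apply: (ll_gy_derivable FL); split => //=; rewrite in_itv.
by apply: (ll_gy_bound FL (z := (x, u))); split => //=; rewrite in_itv.
Qed.

(** Joint continuity on [dom_F] comes from continuity in x at the fixed height y0 together with the
    contraction in y, which is uniform in x. *)
Lemma measurable_g : measurable_fun dom_F (fun z => g z.1 z.2).
Proof.
apply: within_cvg_measurable_fun; first exact: measurable_dom_F.
move=> [x0 y0] [/= dx0 dy0].
have y01 : -1 <= y0 <= 1 by rewrite /= in_itv in dy0.
have gx0 : g u y0 @[u --> within dom_f (nbhs x0)] --> g x0 y0.
  by apply: derivable_on_within => //; apply: (ll_gx_derivable FL).
apply/cvgrPdist_lt => e e0; rewrite near_withinE.
have e2 : 0 < e / 2 by rewrite divr_gt0.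
have /cvgrPdist_lt/(_ _ e2) := gx0; rewrite near_withinE => gx0e.
have Nx : \forall u \near (x0, y0), dom_f u.1 -> `|g x0 y0 - g u.1 y0| < e / 2.
  exact: (@cvg_fst _ _ (nbhs x0) (nbhs y0) _ _ gx0e).
have Ny : \forall u \near (x0, y0), `|y0 - u.2| < e.
  have y0e : \forall y \near y0, `|y0 - y| < e.
    by apply/nbhs_ballP; exists e.
  exact: (@cvg_snd _ _ (nbhs x0) (nbhs y0) _ _ y0e).
near=> u => -[du1 du2].
have uy : -1 <= u.2 <= 1 by rewrite /= in_itv in du2.
rewrite (_ : g x0 y0 - _ = (g x0 y0 - g u.1 y0) + (g u.1 y0 - g u.1 u.2)); last first.
  by rewrite addrA subrK.
rewrite (le_lt_trans (ler_normD _ _))// [ltRHS](splitr e) ltr_leD//.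
  by move: du1; near: u.
rewrite (le_trans (g_lipschitz du1 y01 uy))// mulrC ler_pM2r// ltW//.
by near: u.
Unshelve. all: by end_near. Qed.

(* [F] is only measurable on the square; outside, where nothing is known about
   [f] and [g], it is replaced by the identity. *)
Definition F_ext (z : plane) : plane := if z \in square then F z else z.

Lemma measurable_mem (D : set plane) : measurable D ->
  measurable_fun setT (fun z => z \in D).
Proof.
move=> mD; apply: (measurable_fun_bool true); rewrite setTI.
by rewrite (_ : _ @^-1` _ = D)//; apply/seteqP; split => x /= => [/set_mem|/mem_set].
Qed.

Lemma measurable_fun_patch (D : set plane) {d'} (Y : measurableType d') (u v : plane -> Y) :
  measurable D -> measurable_fun D u -> measurable_fun setT v ->
  measurable_fun setT (fun z => if z \in D then u z else v z).
Proof.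
move=> mD mu mv; apply: measurable_fun_if => //; first exact: measurable_mem.
  rewrite setTI (_ : _ @^-1` _ = D)//.
  by apply/seteqP; split => x /= => [/set_mem|/mem_set].
exact: measurable_funTS.
Qed.

Lemma measurable_F_ext : measurable_fun setT F_ext.
Proof.
have -> : F_ext = fun z =>
    (if z \in dom_F then f z.1 else if z \in square then (if b then 1 else -1) else z.1,
     if z \in dom_F then g z.1 z.2 else if z \in square then (if b then yp else ym) else z.2).
  apply/funext => z; rewrite /F_ext /F_map.
  have [zS|zS] := boolP (z \in square); last first.
    rewrite memNset; first by case: z zS.
    by move=> /dom_FP[/mem_set]; rewrite (negPf zS).
  have [z0|z0] := eqVneq z.1 0.
    rewrite memNset; first by case: (b).
    by move=> /dom_FP[_]; rewrite z0 eqxx.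
  by rewrite mem_set//; apply/dom_FP; split => //; exact: set_mem.
apply: measurable_fun_pair.
  apply: measurable_fun_patch; [exact: measurable_dom_F|exact: measurable_f|].
  apply: measurable_fun_patch; [exact: measurable_square|exact: measurable_cst|].
  exact: measurable_fst.
apply: measurable_fun_patch; [exact: measurable_dom_F|exact: measurable_g|].
apply: measurable_fun_patch; [exact: measurable_square|exact: measurable_cst|].
exact: measurable_snd.
Qed.

Lemma F_ext_square z : square z -> F_ext z = F z.
Proof. by move=> zS; rewrite /F_ext mem_set. Qed.

Lemma iter_F_ext k z : square z -> square (iter k F z) /\ iter k F_ext z = iter k F z.
Proof.
move=> zS; elim: k => [|k [kS kE]] //=.
by split; [exact: F_map_square|rewrite kE F_ext_square].
Qed.

End lorenz.

(** * Invariant measures do not charge the critical line *)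

Section lorenz_measure.
Variables (R : realType) (f : R -> R) (g : R -> R -> R).
Variables (yp ym vl vr rho M : R) (b : bool).
Hypothesis FL : lorenz_like f g yp ym vl vr rho M.
Local Notation plane := (R * R)%type.
Local Notation F := (F_map f g yp ym b).
Local Notation T := (F_ext f g yp ym b).
Local Notation square := (@square R).
Local Notation dom_f := (@dom_f R).
Local Notation dom_F := (@dom_F R).
Variable mu : probability plane R.
Hypothesis mu_inv : invariant_measure f g yp ym b mu.
Hypothesis mu_attr : carried_by_attractor f g yp ym mu.

Lemma attractor_square : attractor f g yp ym `<=` square.
Proof. by move=> z /(_ 0%N I). Qed.

Lemma measure_squareC : mu (~` square) = 0%E.
Proof.
apply/negligibleP; first by apply: measurableC; exact: measurable_square.
by apply: negligibleS mu_attr => z /= zS /attractor_square.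
Qed.

Lemma F_ext_invariant B : measurable B -> mu (T @^-1` B) = mu B.
Proof.
move=> mB; rewrite -(mu_inv mB) /F_preimage.
rewrite -(measureI_full (S := square) _ _ measure_squareC); last exact: measurable_square.
  congr (mu _); apply/seteqP; split => z [].
    by move=> Tz zS; split => //; rewrite /preimage/= -F_ext_square.
  by move=> zS Fz; split => //; rewrite /preimage/= F_ext_square.
by rewrite -[X in measurable X]setTI; exact: (measurable_F_ext b FL).
Qed.

Let L (x : R) : set plane := [set z | z.1 = x].

Let measurable_L x : measurable (L x).
Proof.
rewrite (_ : L x = [set x] `*` setT); first exact: measurableX.
by apply/seteqP; split => z //= [].
Qed.

Let orbit0 n : R :=
  iter n (fun x => if x == 0 then (if b then 1 else -1) else f x) 0.

Lemma measure_critical_line : mu [set z | z.1 = 0] = 0%E.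
Proof.
have stepE z : (F z).1 = if z.1 == 0 then (if b then 1 else -1) else f z.1.
  by rewrite /F_map; case: ifP => //; case: (b).
(* Only the first coordinate of the image of (orbit0 n, 0) is kept: invariance of the square shows
   that [orbit0] stays in [-1, 1]. *)
have orbS n : square (orbit0 n, 0).
  elim: n => [|n IH]; first by split => /=; rewrite in_itv/=; lra.
  have := F_map_square b FL IH; rewrite /Defs.square /= stepE /= => -[h1 _].
  by split => //=; rewrite in_itv/=; lra.
have inj : injective orbit0.
  have orbit0S n : orbit0 n.+1 =
    if orbit0 n == 0 then (if b then 1 else -1) else f (orbit0 n) by [].
  apply: (ll_aperiodic FL) => // n; rewrite /f_step orbit0S.
  have [u0|u0] := eqVneq (orbit0 n) 0.
    right; split => //; case: (b); by [left|right].
  left; split; last by [].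
  by apply/dom_fP; split => //; have [] := orbS n; rewrite /= in_itv.
have nd n : (mu (L (orbit0 0%N)) <= mu (L (orbit0 n)))%E.
  elim: n => // n IH; apply: (le_trans IH).
  rewrite -(F_ext_invariant (measurable_L (orbit0 n.+1))).
  rewrite -(measureI_full (measurable_L _) (@measurable_square R) measure_squareC).
  apply: le_measure; rewrite ?inE.
  - by apply: measurableI; [exact: measurable_L|exact: measurable_square].
  - by rewrite -[X in measurable X]setTI; exact: (measurable_F_ext b FL).
  - by move=> z [/= zn zS]; rewrite /L/= F_ext_square// stepE zn.
have disj : trivIset setT (L \o orbit0).
  by move=> i j _ _ [z []]; rewrite /L/= => -> /inj.
have bnd N : (N%:R%:E * mu (L (orbit0 0%N)) <= 1)%E.
  apply: (@le_trans _ _ (\sum_(i < N) mu (L (orbit0 i)))%E).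
    rewrite mule_natl -[leLHS](_ : (\sum_(i < N) mu (L (orbit0 0%N)) = _)%E).
      by apply: lee_sum => i _; exact: nd.
    by rewrite sumr_const card_ord.
  rewrite -(@measure_bigsetU _ _ _ mu (L \o orbit0)) //; last by move=> i; exact: measurable_L.
  by apply: probability_le1; apply: bigsetU_measurable => i _; exact: measurable_L.
apply/eqP; rewrite eq_le measure_ge0 andbT leNgt; apply/negP => mpos.
have mfin : mu (L 0) \is a fin_num by exact: fin_num_measure.
have m0 : 0 < fine (mu (L 0)) by rewrite -lte_fin fineK.
have /archi_boundP : 0 <= (fine (mu (L 0)))^-1 by rewrite invr_ge0 ltW.
set N := Num.bound _ => hN; have := bnd N; rewrite -(fineK mfin) -EFinM lee_fin.
by apply/negP; rewrite -ltNge -ltr_pdivrMr// div1r.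
Qed.

Lemma measure_dom_FC : mu (~` dom_F) = 0%E.
Proof.
apply/negligibleP; first by apply: measurableC; exact: measurable_dom_F.
apply: (@negligibleS _ _ _ _ (~` square `|` L 0)).
  move=> z; have [z0|z0] := eqVneq z.1 0; first by right.
  by move=> nz; left => zS; apply: nz; apply/dom_FP.
apply: negligibleU.
  by apply/negligibleP; [apply: measurableC; exact: measurable_square|exact: measure_squareC].
by apply/negligibleP; [exact: measurable_L|exact: measure_critical_line].
Qed.

Lemma ae_orbit_dom_F : {ae mu, forall z, forall k, dom_F (iter k F z)}.
Proof.
have : \forall z \ae mu, forall k, dom_F (iter k T z).
  apply: ae_foralln => k; exists (iter k T @^-1` (~` dom_F)); split => //.
  - rewrite -[X in measurable X]setTI; apply: (measurable_iter (measurable_F_ext b FL)) => //.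
    by apply: measurableC; exact: measurable_dom_F.
  - apply: (etrans (measure_preimage_iter (measurable_F_ext b FL) F_ext_invariant k _)).
      by apply: measurableC; exact: measurable_dom_F.
    exact: measure_dom_FC.
apply: filterS => z zT k.
have zS : square z by have /dom_FP[] := zT 0%N.
by have [_ <-] := iter_F_ext b FL k zS.
Qed.

End lorenz_measure.

(** * Growth rates of vectors *)

Section growth_rates.
Variables (R : realType) (f : R -> R) (g : R -> R -> R).
Variables (yp ym vl vr rho M : R) (b : bool).
Hypothesis FL : lorenz_like f g yp ym vl vr rho M.
Local Notation plane := (R * R)%type.
Local Notation F := (F_map f g yp ym b).
Local Notation dom_F := (@dom_F R).
Local Open Scope ereal_scope.

Lemma norm_pairE (p : plane) : (`|p| = Num.max `|p.1| `|p.2|)%R.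
Proof. by case: p. Qed.

(** The sign makes it nonnegative, with value +oo where dg/dy vanishes. Off [dom_F] it takes the
    lower bound itself as value, so that [contraction_ge] holds everywhere; [expansion] is completed
    in the same way. *)
Definition contraction (z : plane) : \bar R :=
  if z \in dom_F then - lne (`|dg_y g z|)%:E else (ln 2)%:E.

Definition expansion (z : plane) : \bar R :=
  if z \in dom_F then lne (`|df f z.1|)%:E else (ln (Num.sqrt 2))%:E.

Lemma measurable_contraction : measurable_fun setT contraction.
Proof.
apply: measurable_fun_patch; [exact: measurable_dom_F| |exact: measurable_cst].
apply: measurableT_comp => //; apply: measurable_lne_norm; first exact: measurable_dom_F.
exact: measurable_dg_y FL.
Qed.

Lemma measurable_expansion : measurable_fun setT expansion.
Proof.
apply: measurable_fun_patch; [exact: measurable_dom_F| |exact: measurable_cst].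
apply: measurable_lne_norm; first exact: measurable_dom_F.
exact: measurable_df FL.
Qed.

Lemma contraction_ge z : (ln 2)%:E <= contraction z.
Proof.
rewrite /contraction; case: ifPn => // /set_mem dz.
rewrite leeNr -EFinN -lnV ?posrE// -lne_EFin ?invr_gt0//.
by apply: le_lne => //; exact: ll_gy_bound FL _ dz.
Qed.

Lemma sqrt2_le_norm_df z : dom_F z -> (Num.sqrt 2 <= `|df f z.1|)%R.
Proof. by case=> dz _; rewrite (le_trans (ll_f_expanding FL dz))// ler_norm. Qed.

Lemma expansion_ge z : (ln (Num.sqrt 2))%:E <= expansion z.
Proof.
rewrite /expansion; case: ifPn => // /set_mem dz.
by rewrite -lne_EFin ?sqrtr_gt0//; apply: le_lne => //; exact: sqrt2_le_norm_df.
Qed.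

Lemma ln2_gt0 : (0 < ln 2 :> R)%R.
Proof. by rewrite ln_gt0// ltr1n. Qed.

Lemma sqrt2_gt1 : (1 < Num.sqrt 2 :> R)%R.
Proof. by rewrite -[ltLHS]sqrtr1 ltr_sqrt// ltr1n. Qed.

Lemma ln_sqrt2_gt0 : (0 < ln (Num.sqrt 2) :> R)%R.
Proof. by rewrite ln_gt0// sqrt2_gt1. Qed.

Lemma contraction_ge0 z : 0 <= contraction z.
Proof. by rewrite (le_trans _ (contraction_ge z))// lee_fin ltW// ln2_gt0. Qed.

Lemma expansion_ge0 z : 0 <= expansion z.
Proof. by rewrite (le_trans _ (expansion_ge z))// lee_fin ltW// ln_sqrt2_gt0. Qed.

Section orbit.
Variable z : plane.
Hypothesis zdom : forall k, dom_F (iter k F z).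
Local Notation D n v := (DF_iter f g yp ym b n z v).

Lemma lne_DF_iter_fst n (v : plane) : v.1 != 0%R ->
  lne (`|(D n v).1|)%:E = (ln `|v.1|)%:E + \sum_(k < n) expansion (iter k F z).
Proof.
move=> v0; elim: n => [|n IH].
  by rewrite big_ord0 adde0 lne_EFin// normr_gt0.
have -> : (D n.+1 v).1 = (df f (iter n F z).1 * (D n v).1)%R by [].
rewrite big_ord_recr addeA -IH normrM lneM_ge0// addeC; congr (_ + _).
by rewrite /expansion mem_set.
Qed.

Lemma DF_iter_fst0 n (v : plane) : v.1 = 0%R -> (D n v).1 = 0%R.
Proof. by move=> v0; elim: n => //= n ->; rewrite mulr0. Qed.

(** A vertical vector stays vertical, so only dg/dy acts on it. Once dg/dy has vanished along the
    orbit, both sides are -oo. *)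
Lemma lne_DF_iter_snd n (v : plane) : v.1 = 0%R -> v.2 != 0%R ->
  lne (`|(D n v).2|)%:E = (ln `|v.2|)%:E - \sum_(k < n) contraction (iter k F z).
Proof.
move=> v1 v2; elim: n => [|n IH].
  by rewrite big_ord0 oppe0 adde0 lne_EFin// normr_gt0.
have -> : (D n.+1 v).2 = (dg_y g (iter n F z) * (D n v).2)%R.
  by rewrite [LHS]/= DF_iter_fst0// mulr0 add0r.
rewrite big_ord_recr oppeD; last first.
  by apply: ge0_adde_def; rewrite inE ?contraction_ge0// sume_ge0// => k _; exact: contraction_ge0.
rewrite addeA -IH normrM lneM_ge0// addeC; congr (_ + _).
by rewrite /contraction mem_set// oppeK.
Qed.

Lemma growth_rate_vertical (s : \bar R) (v : plane) : v.1 = 0%R -> v.2 != 0%R ->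
  n%:R^-1%:E * \sum_(k < n) contraction (iter k F z) @[n --> \oo] --> s ->
  growth_rate f g yp ym b z v @ \oo --> - s.
Proof.
move=> v1 v2 /cvgeN Hs.
have E n : growth_rate f g yp ym b z v n =
    n%:R^-1%:E * ((ln `|v.2|)%:E + - \sum_(k < n) contraction (iter k F z)).
  rewrite /growth_rate -lne_DF_iter_snd//; congr (_ * lne _%:E).
  by rewrite norm_pairE DF_iter_fst0// normr0; apply/max_idPr.
rewrite (funext E); apply: average_shift_cvg.
by under eq_fun do rewrite muleN.
Qed.

(** The cone |v.2| <= C |v.1| is preserved: the new vertical part is at most (M + C / 2) |v.1|,
    hence at most C |v.1| when C >= 2 M, and |v.1| does not decrease because |f'| >= 1. *)
Lemma DF_iter_cone (v : plane) : v.1 != 0%R ->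
  exists2 C : R, (1 <= C)%R & forall n, (`|(D n v).2| <= C * `|(D n v).1|)%R.
Proof.
(* The term 2 M makes the cone invariant, the slope of [v] places [v] inside it, and 1 bounds the
   max norm by C |v.1|. *)
move=> v0; pose C := (1 + 2 * M + `|v.2| / `|v.1|)%R.
have M0 := ltW (ll_M FL).
have C1 : (1 <= C)%R.
  by rewrite /C -addrA lerDl addr_ge0// ?mulr_ge0// divr_ge0.
exists C => //; elim => [|n IH] /=.
  rewrite -ler_pdivrMr ?normr_gt0// /C lerDr addr_ge0// mulr_ge0//.
have zd := zdom n.
have gx := ll_gx_bound FL zd; have gy := ll_gy_bound FL zd.
have fx : (1 <= `|df f (iter n F z).1|)%R.
  by rewrite (le_trans _ (sqrt2_le_norm_df zd))// ltW// sqrt2_gt1.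
rewrite (le_trans (ler_normD _ _))// !normrM.
set a := `|(D n v).1|%R in IH *; set c := `|(D n v).2|%R in IH *.
have a0 : (0 <= a)%R by exact: normr_ge0.
have c0 : (0 <= c)%R by exact: normr_ge0.
apply: (@le_trans _ _ (M * a + 2^-1 * (C * a))%R).
  by apply: lerD; [exact: ler_wpM2r|exact: ler_pM].
apply: (@le_trans _ _ (C * a)%R); last first.
  by rewrite ler_wpM2l ?(le_trans ler01)// ler_peMl.
have CM : (M <= 2^-1 * C)%R.
  have : (0 <= `|v.2| / `|v.1|)%R by rewrite divr_ge0.
  by rewrite /C; lra.
by have := ler_wpM2r a0 CM; lra.
Qed.

(** By the cone estimate the max norm lies between |v.1| and C |v.1|; the factor C adds ln C to the
    logarithm, which disappears in the average. *)
Lemma growth_rate_nonvertical (s : \bar R) (v : plane) : v.1 != 0%R ->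
  n%:R^-1%:E * \sum_(k < n) expansion (iter k F z) @[n --> \oo] --> s ->
  growth_rate f g yp ym b z v @ \oo --> s.
Proof.
move=> v0 Hs; have [C C1 cone] := DF_iter_cone v0.
have C0 : (0 < C)%R by rewrite (lt_le_trans _ C1).
have lower := average_shift_cvg (ln `|v.1|) Hs.
have upper := average_shift_cvg (ln C + ln `|v.1|)%R Hs.
apply: squeeze_cvge lower upper.
apply: nearW => n; rewrite /growth_rate.
rewrite EFinD -addeA -lne_DF_iter_fst// -lne_EFin// -lneM_ge0// ?(ltW C0)//.
apply/andP; split; apply: lee_wpmul2l; rewrite ?lee_fin//; apply: le_lne; rewrite ?norm_pairE//.
  by rewrite le_max lexx.
by rewrite ge_max cone andbT ler_peMl.
Qed.

End orbit.

(** If the slow line were not vertical, its vectors would grow at rate [s2] and the vertical vectors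
    outside it at rate - s1, so that c2 = - s1 < s2 = c1, against c1 <= c2. *)
Lemma lyapunov_exponents_at_unique (z : plane) (s1 s2 c1 c2 : \bar R) :
  - s1 < s2 ->
  (forall v : plane, v.1 = 0%R -> v.2 != 0%R -> growth_rate f g yp ym b z v @ \oo --> - s1) ->
  (forall v : plane, v.1 != 0%R -> growth_rate f g yp ym b z v @ \oo --> s2) ->
  lyapunov_exponents_at f g yp ym b z c1 c2 -> c1 = - s1 /\ c2 = s2.
Proof.
move=> s12 vert nonvert [c12 [w [w0 wc1 wc2]]].
have uniq (v : plane) (x y : \bar R) : growth_rate f g yp ym b z v @ \oo --> x ->
    growth_rate f g yp ym b z v @ \oo --> y -> x = y.
  by move=> vx vy; rewrite -(cvg_lim _ vx)// -(cvg_lim _ vy).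
have wline : on_line w w by exists 1%R; rewrite scale1r.
have [w1|w1] := eqVneq w.1 0%R.
  have w2 : w.2 != 0%R.
    by apply: contra w0 => /eqP w2; rewrite [w]surjective_pairing w1 w2.
  split; first exact: uniq (wc1 w w0 wline) (vert w w1 w2).
  apply: (uniq (1, 0)%R); last by apply: nonvert; rewrite oner_neq0.
  by apply: wc2 => -[c [/eqP]]; rewrite w1 [_ *: _]mulr0 oner_eq0.
have e1 := uniq _ _ _ (wc1 w w0 wline) (nonvert w w1).
have e2 : c2 = - s1.
  apply: (uniq (0, 1)%R); last by apply: vert => //=; rewrite oner_neq0.
  apply: wc2 => -[c [/esym/eqP]]; rewrite mulf_eq0 (negPf w1) orbF => /eqP ->.
  by move/eqP; rewrite [_ *: _]mul0r oner_eq0.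
by move: c12; rewrite e1 e2 leNgt s12.
Qed.

End growth_rates.

(** * Lyapunov exponents as Birkhoff limits *)

Section averages.
Local Open Scope ereal_scope.

Lemma average_limit_ge (R : realType) (c : R) (h : (\bar R)^nat) (s : \bar R) :
  (forall k, c%:E <= h k) -> n%:R^-1%:E * \sum_(k < n) h k @[n --> \oo] --> s ->
  c%:E <= s.
Proof.
move=> ch hs; rewrite -(cvg_lim _ hs)//.
apply: lime_ge; first by apply/cvg_ex; eexists; exact: hs.
exists 1%N => // n /= n0; rewrite lee_pdivlMl ?ltr0n// mule_natl.
rewrite -[leLHS](_ : \sum_(k < n) c%:E = _); first exact: lee_sum.
by rewrite sumr_const card_ord.
Qed.

End averages.

Section lorenz_exponents.
Variables (R : realType) (f : R -> R) (g : R -> R -> R).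
Variables (yp ym vl vr rho M : R) (b : bool).
Hypothesis FL : lorenz_like f g yp ym vl vr rho M.
Local Notation plane := (R * R)%type.
Local Notation F := (F_map f g yp ym b).
Local Notation T := (F_ext f g yp ym b).
Local Notation square := (@square R).
Local Notation dom_F := (@dom_F R).
Variable mu : probability plane R.
Hypothesis mu_inv : invariant_measure f g yp ym b mu.
Hypothesis mu_attr : carried_by_attractor f g yp ym mu.
Local Open Scope ereal_scope.

(** An observable that is uncontrolled off [dom_F] is exchanged for one that is signed and
    measurable on the whole plane. The null set [N] contains the complement of the attractor, so
    [dom_F] minus [N] is a measurable set of full measure inside it. *)
Lemma integral_attractor (u v : plane -> \bar R) : (forall z, dom_F z -> u z = v z) ->
  \int[mu]_(z in attractor f g yp ym) u z = \int[mu]_z v z.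
Proof.
move=> uv; rewrite integral_mkcond.
have [N [mN N0 attrN]] := mu_attr.
have mA : measurable (dom_F `&` ~` N).
  by apply: measurableI; [exact: measurable_dom_F|exact: measurableC].
apply: (eq_integral_full mA).
  apply/negligibleP; first exact: measurableC.
  rewrite setCI setCK; apply: negligibleU; last by apply/negligibleP.
  apply/negligibleP; first by apply: measurableC; exact: measurable_dom_F.
  exact: (measure_dom_FC FL mu_inv mu_attr).
move=> z [dz nNz]; rewrite patchE mem_set ?uv//.
by apply: contrapT => nz; apply: nNz; exact: attrN.
Qed.

(** Ergodicity speaks of sets equal to their [F_preimage], and these lie in the square; the
    invariant sublevel sets of [hs] are therefore intersected with the square, which has full
    measure. *)
Lemma ergodic_ae_constant (hs : plane -> \bar R) :
  ergodic_measure f g yp ym b mu -> measurable_fun setT hs ->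
  (forall z, hs (T z) = hs z) -> {ae mu, forall z, hs z = \int[mu]_x hs x}.
Proof.
move=> erg mhs hsT; apply: ae_eq_integral_of_01 => // q.
set A := [set z | _].
have mA : measurable A.
  by rewrite -[X in measurable X]setTI; exact: emeasurable_fun_infty_o.
rewrite -(measureI_full mA (@measurable_square R) (measure_squareC mu_attr)).
apply: erg; first by apply: measurableI => //; exact: measurable_square.
apply/seteqP; split => z; rewrite /F_preimage /=.
  by move=> [zS [+ _]]; rewrite /A /= -(F_ext_square _ _ _ _ _ zS) hsT.
move=> [Az zS]; split => //; split; last exact: F_map_square FL _ zS.
by rewrite /A /= -(F_ext_square _ _ _ _ _ zS) hsT.
Qed.

(** The last clause determines the exponents almost everywhere, so that what is known of [s1] and
    [s2] carries over to any admissible pair [chi1], [chi2]. *)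
Lemma ae_lyapunov_exponents : exists s1 s2 : plane -> \bar R,
  [/\ [/\ measurable_fun setT s1, measurable_fun setT s2,
          \int[mu]_z s1 z = \int[mu]_z contraction g z &
          \int[mu]_z s2 z = \int[mu]_z expansion f z],
      (forall z, 0 <= s1 z) /\ (forall z, s1 (T z) = s1 z) /\ (forall z, s2 (T z) = s2 z),
      {ae mu, forall z, 0 < s1 z /\ 0 < s2 z},
      {ae mu, forall z, lyapunov_exponents_at f g yp ym b z (- s1 z) (s2 z)} &
      {ae mu, forall z c1 c2, lyapunov_exponents_at f g yp ym b z c1 c2 ->
         c1 = - s1 z /\ c2 = s2 z}].
Proof.
have mT := measurable_F_ext b FL.
have invT := F_ext_invariant FL mu_inv mu_attr.
have [s1 [ms1 s10 s1T s1cvg s1int]] :=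
  birkhoff_ge0 mT invT (measurable_contraction FL) (contraction_ge0 FL).
have [s2 [ms2 s20 s2T s2cvg s2int]] :=
  birkhoff_ge0 mT invT (measurable_expansion FL) (expansion_ge0 FL).
have good : {ae mu, forall z, [/\ forall k, dom_F (iter k F z),
    n%:R^-1%:E * \sum_(k < n) contraction g (iter k F z) @[n --> \oo] --> s1 z &
    n%:R^-1%:E * \sum_(k < n) expansion f (iter k F z) @[n --> \oo] --> s2 z]}.
  move: (ae_orbit_dom_F FL mu_inv mu_attr) s1cvg s2cvg.
  apply: filterS3 => z zdom c1 c2.
  have zS : square z by have /dom_FP[] := zdom 0%N.
  have iterE k : iter k T z = iter k F z by have [_ ->] := iter_F_ext b FL k zS.
  split => //.
    by under eq_fun do under eq_bigr do rewrite -iterE; exact: c1.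
  by under eq_fun do under eq_bigr do rewrite -iterE; exact: c2.
have pos : {ae mu, forall z, 0 < s1 z /\ 0 < s2 z}.
  apply: filterS good => z [_ c1 c2]; split.
    apply: (@lt_le_trans _ _ (ln 2)%:E); first by rewrite lte_fin ln2_gt0.
    exact: (average_limit_ge (fun k => contraction_ge FL (iter k F z)) c1).
  apply: (@lt_le_trans _ _ (ln (Num.sqrt 2))%:E); first by rewrite lte_fin ln_sqrt2_gt0.
  exact: (average_limit_ge (fun k => expansion_ge FL (iter k F z)) c2).
have lt12 z : 0 < s1 z /\ 0 < s2 z -> - s1 z < s2 z.
  by move=> [p1 p2]; rewrite (lt_trans _ p2)// oppe_lt0.
exists s1, s2; split => //.
- move: good pos; apply: filterS2 => z [zdom c1 c2] /lt12 p12; split; first exact: ltW.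
  exists (0, 1)%R; split.
  + by apply/eqP => -[/eqP]; rewrite oner_eq0.
  + move=> v v0 [c vE]; apply: (growth_rate_vertical FL zdom) c1.
      by rewrite vE /= [_ *: _]mulr0.
    apply: contra v0 => /eqP v2; rewrite [v]surjective_pairing v2 vE /= [_ *: _]mulr0.
    by rewrite eqxx.
  + move=> v nv; apply: (growth_rate_nonvertical FL zdom) c2.
    apply/eqP => v1; apply: nv; exists v.2.
    by rewrite [v]surjective_pairing v1 /=; congr pair; rewrite ?[_ *: _]mulr0 ?[_ *: _]mulr1.
- move: good pos; apply: filterS2 => z [zdom c1 c2] /lt12 p12 x1 x2.
  apply: lyapunov_exponents_at_unique => // v.
    by move=> v1 v2; exact: (growth_rate_vertical FL zdom).
  by move=> v1; exact: (growth_rate_nonvertical FL zdom).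
Qed.

End lorenz_exponents.

Theorem corollaryB (R : realType) (f : R -> R) (g : R -> R -> R)
    (yp ym vl vr rho M : R) (b : bool)
    (FL : lorenz_like f g yp ym vl vr rho M)
    (mu : probability (R * R)%type R)
    (mu_inv : invariant_measure f g yp ym b mu)
    (mu_attr : carried_by_attractor f g yp ym mu) :
  let I1 := (\int[mu]_(z in attractor f g yp ym) lne (`|dg_y g z|)%:E)%E in
  let I2 := (\int[mu]_(z in attractor f g yp ym) lne (`|df f z.1|)%:E)%E in
  [/\ hyperbolic_measure f g yp ym b mu,
      forall chi1 chi2, lyapunov_exponents f g yp ym b mu chi1 chi2 ->
        [/\ (\int[mu]_z chi1 z)%E = I1,
            (\int[mu]_z chi2 z)%E = I2 &
            ergodic_measure f g yp ym b mu ->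
              {ae mu, forall z, chi1 z = I1 /\ chi2 z = I2}],
      (I1 < 0)%E &
      (0 < I2 <= +oo)%E].
Proof.
move=> I1 I2.
(* The integrand has constant sign on [dom_F], so the minus sign leaves the integral even when its
   value is infinite. *)
have I1E : I1 = (- \int[mu]_z contraction g z)%E.
  rewrite -integral_ge0N; last by move=> z _; exact: contraction_ge0 FL _.
  apply: (integral_attractor FL mu_inv mu_attr) => z dz.
  by rewrite /contraction mem_set// oppeK.
have I2E : I2 = (\int[mu]_z expansion f z)%E.
  apply: (integral_attractor FL mu_inv mu_attr) => z dz.
  by rewrite /expansion mem_set.
have int_ge (c : R) (h : R * R -> \bar R) : 0 < c -> measurable_fun setT h ->
    (forall z, c%:E <= h z)%E -> (0 < \int[mu]_z h z)%E.
  move=> c0 mh ch; apply: (@lt_le_trans _ _ c%:E); first by rewrite lte_fin.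
  rewrite -[leLHS]mule1 -(probability_setT mu) -integral_cst//.
  by apply: ge0_le_integral => // z _; rewrite lee_fin ltW.
have [s1 [s2 [[ms1 ms2 s1int s2int] [s10 [s1T s2T]] pos expo uniq]]] :=
  ae_lyapunov_exponents FL mu_inv mu_attr.
split.
- exists (fun z => - s1 z)%E, s2; split; first by split => //; exact: measurableT_comp.
  apply: filterS pos => z [p1 p2]; split; last by rewrite gt_eqF.
  by rewrite lt_eqF// oppe_lt0.
- move=> chi1 chi2 [mchi1 mchi2 chi].
  have chiE : {ae mu, forall z, chi1 z = (- s1 z)%E /\ chi2 z = s2 z}.
    by move: uniq chi; apply: filterS2 => z H; exact: H.
  split.
  + rewrite I1E -s1int -integral_ge0N//; apply: ae_eq_integral => //.
      exact: measurableT_comp.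
    by apply: filterS chiE => z [].
  + rewrite I2E -s2int; apply: ae_eq_integral => //.
    by apply: filterS chiE => z [].
  + move=> erg; move: chiE (ergodic_ae_constant FL mu_attr erg ms1 s1T)
      (ergodic_ae_constant FL mu_attr erg ms2 s2T).
    by apply: filterS3 => z [-> ->] -> ->; rewrite I1E I2E s1int s2int.
- rewrite I1E oppe_lt0; apply: (int_ge (ln 2)); first exact: ln2_gt0.
    exact: measurable_contraction FL.
  exact: contraction_ge FL.
- rewrite leey andbT I2E; apply: (int_ge (ln (Num.sqrt 2))); first exact: ln_sqrt2_gt0.
    exact: measurable_expansion FL.
  exact: expansion_ge FL.
Qed.
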